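(* Let $R$ be a Noetherian local ring and $E$ a finitely generated $R$-module having rank $e$ with $\operatorname{proj\,dim}E=1$. Then $$\ell\Big(\bigwedge\nolimits^{e}E\Big)\ \ge\ \operatorname{ht}F_e(E).$$
   Context: A finitely generated module $E$ over a Noetherian ring $R$ with total ring of fractions $Q$ has rank $e$ if $E\otimes_RQ\simeq Q^e$. $\tau_R(M)$ is the submodule of elements of $M$ killed by a non-zero-divisor of $R$. For a finitely generated module $M$ having a rank, over a Noetherian local ring $(R,\mathfrak m,k)$, the Rees algebra is $\mathcal R(M)=\mathcal S(M)/\tau_R(\mathcal S(M))$, where $\mathcal S(M)$ is the symmetric algebra, and the analytic spread $\ell(M)$ is the Krull dimension of $\mathcal R(M)\otimes_Rk$. $F_i(M)$ is the $i$-th Fitting ideal: if $R^m\xrightarrow{\varphi}R^n\to M\to 0$ is a finite presentation, $F_i(M)$ is the ideal generated by the $(n-i)\times(n-i)$ minors of $\varphi$. *)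

(* Defs.v *)
From HB Require Import structures.
From mathcomp Require Import all_boot all_order all_algebra.
From mathcomp Require Import generic_quotient ring_quotient.
From mathcomp Require Import ring finmap monalg.
From mathcomp Require Import boolp classical_sets constructive_ereal.

Set Implicit Arguments.
Unset Strict Implicit.
Unset Printing Implicit Defensive.

Import Order.TTheory GRing.Theory.

Local Open Scope classical_set_scope.
Local Open Scope quotient_scope.
Local Open Scope ring_scope.

Section Ideals.
Variable A : comPzRingType.
Implicit Types (I J P X : set A).

Definition is_ideal I : Prop :=
  I 0 /\ forall a x y, I x -> I y -> I (a * x + y).

Definition ideal_span X : set A :=
  [set x | forall I, is_ideal I -> X `<=` I -> I x].

Definition is_prime_ideal P : Prop :=
  [/\ is_ideal P, ~ P 1 & forall x y, P (x * y) -> P x \/ P y].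

Definition is_maximal_ideal I : Prop :=
  [/\ is_ideal I, ~ I 1
    & forall J, is_ideal J -> ~ J 1 -> I `<=` J -> J = I].

Definition prime_chain (n : nat) (p : nat -> set A) : Prop :=
  (forall i, (i <= n)%N -> is_prime_ideal (p i)) /\
  (forall i, (i < n)%N -> p i `<` p i.+1).

(* The Krull dimension of the zero ring is -oo. *)
Definition krull_dim : \bar int :=
  supremum -oo%E [set (n%:Z)%:E | n in [set n | exists p, prime_chain n p]].

Definition prime_height P : \bar int :=
  supremum -oo%E
    [set (n%:Z)%:E | n in [set n | exists2 p, prime_chain n p & p n = P]].

(* The height of the unit ideal is +oo. *)
Definition ideal_height I : \bar int :=
  infimum +oo%E
    [set prime_height P | P in [set P | is_prime_ideal P /\ I `<=` P]].

Definition is_noetherian : Prop :=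
  forall I, is_ideal I -> exists s : seq A, I = ideal_span [set` s].

Lemma ideal_spanP X : is_ideal (ideal_span X).
Proof.
split=> [I [I0 _] _ //|a x y Xx Xy I hI XI].
by apply: hI.2; [apply: Xx|apply: Xy].
Qed.

End Ideals.

Arguments krull_dim A : clear implicits.
Arguments is_noetherian A : clear implicits.

Definition is_local (R : comNzRingType) (m : idealr R) : Prop :=
  forall I : set R, is_maximal_ideal I <-> I = [set` (m : pred R)].

Section Modules.
Variable R : comNzRingType.

Definition submodule_closed (V : lmodType R) (N : set V) : Prop :=
  N 0 /\ forall a x y, N x -> N y -> N (a *: x + y).

Record submodule (V : lmodType R) := Submodule {
  submodule_set :> V -> Prop;
  submodule_setP : submodule_closed submodule_set
}.

Section Span.
Variable V : lmodType R.

Definition span_set (X : set V) : set V :=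
  [set x | forall N, submodule_closed N -> X `<=` N -> N x].

Lemma span_setP X : submodule_closed (span_set X).
Proof.
split=> [N [N0 _] _ //|a x y Xx Xy N hN XN].
by apply: hN.2; [apply: Xx|apply: Xy].
Qed.

Definition span X : submodule V := Submodule (span_setP X).

Lemma sub_span X x : X x -> span X x.
Proof. by move=> Xx N _; apply. Qed.

Definition submodule_pred (N : submodule V) : {pred V} := fun x => `[< N x >].

Lemma submodule_predP N : subsemimod_closed (submodule_pred N).
Proof.
have [N0 NL] := submodule_setP N; split; first split.
- exact/asboolP.
- move=> x y /asboolP Nx /asboolP Ny.
  by apply/asboolP; rewrite -[x]scale1r; apply: NL.
- move=> a x /asboolP Nx.
  by apply/asboolP; rewrite -[_ *: _]addr0; apply: NL.
Qed.

HB.instance Definition _ (N : submodule V) :=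
  GRing.isSubmodClosed.Build R V (submodule_pred N) (submodule_predP N).

End Span.

Definition fin_gen (M : lmodType R) : Prop :=
  exists s : seq M, forall x, span [set` s] x.

Definition torsion (M : lmodType R) : set M :=
  [set x | exists2 r : R, GRing.lreg r & r *: x = 0].

End Modules.

Section ModuleQuotient.
Variables (R : comNzRingType) (V : lmodType R) (N : submodule V).

Definition lquot : Type := @Quotient.quot V (submodule_pred N).
HB.instance Definition _ := GRing.Zmodule.on lquot.

Definition lpi : V -> lquot := \pi_lquot.

Lemma lpiE x y : (lpi x = lpi y) <-> N (x - y).
Proof.
split=> [/eqP|Nxy].
  by rewrite /lpi -Quotient.idealrBE => /asboolP.
by apply/eqP; rewrite /lpi -Quotient.idealrBE; apply/asboolP.
Qed.

Lemma lpi_surj (x : lquot) : exists v, lpi v = x.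
Proof. by exists (repr x); apply: reprK. Qed.

Lemma lpi_zmod : zmod_morphism lpi.
Proof. by move=> x y; rewrite /lpi /= !piE. Qed.
HB.instance Definition _ := GRing.isZmodMorphism.Build V lquot lpi lpi_zmod.

Definition lquot_scale (a : R) : lquot -> lquot := lift_op1 lquot (GRing.scale a).

Lemma lquot_scaleE a v : lquot_scale a (lpi v) = lpi (a *: v).
Proof.
rewrite /lquot_scale; unlock; apply/lpiE; rewrite -scalerBr -[_ *: _]addr0.
have [N0 NL] := submodule_setP N.
by apply: NL => //; apply/lpiE; apply: reprK.
Qed.

Lemma lquot_scaleA a b x :
  lquot_scale a (lquot_scale b x) = lquot_scale (a * b) x.
Proof. by have [v <-] := lpi_surj x; rewrite !lquot_scaleE scalerA. Qed.

Lemma lquot_scale1 : left_id 1 lquot_scale.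
Proof. by move=> x; have [v <-] := lpi_surj x; rewrite lquot_scaleE scale1r. Qed.

Lemma lquot_scaleDr : right_distributive lquot_scale +%R.
Proof.
move=> a x y; have [v <-] := lpi_surj x; have [w <-] := lpi_surj y.
by rewrite -raddfD !lquot_scaleE scalerDr raddfD.
Qed.

Lemma lquot_scaleDl x : {morph lquot_scale^~ x : a b / a + b}.
Proof.
move=> a b; have [v <-] := lpi_surj x.
by rewrite !lquot_scaleE scalerDl raddfD.
Qed.

HB.instance Definition _ := GRing.Zmodule_isLmodule.Build R lquot
  lquot_scaleA lquot_scale1 lquot_scaleDr lquot_scaleDl.

Lemma lpi_scalable : scalable lpi.
Proof. by move=> a v; rewrite -lquot_scaleE. Qed.
HB.instance Definition _ := GRing.isScalable.Build R V lquot *:%R lpi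
  lpi_scalable.

Section Lift.
Variables (W : lmodType R) (f : {linear V -> W}).
Hypothesis fN : forall x, N x -> f x = 0.

Definition lquot_lift : lquot -> W := lift_fun1 lquot f.

Lemma lquot_liftE v : lquot_lift (lpi v) = f v.
Proof.
rewrite /lquot_lift; unlock; apply/eqP; rewrite -subr_eq0 -linearB.
exact/eqP/fN/lpiE/reprK.
Qed.

Lemma lquot_lift_linear : linear lquot_lift.
Proof.
move=> a x y; have [v <-] := lpi_surj x; have [w <-] := lpi_surj y.
by rewrite -linearP !lquot_liftE linearP.
Qed.

End Lift.
End ModuleQuotient.

Section FreeModule.
Variables (R : comNzRingType) (K : choiceType) (W : lmodType R) (h : K -> W).

Definition malg_lift (g : {malg R[K]}) : W :=
  (\sum_(k <- msupp g) g@_k *: h k)%R.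

Lemma malg_liftEw (d : {fset K}) (g : {malg R[K]}) : (msupp g `<=` d)%fset ->
  malg_lift g = \sum_(k <- d) g@_k *: h k.
Proof.
move=> le; rewrite /malg_lift.
apply: big_fset_incl => // k _ kg.
by rewrite mcoeff_outdom // scale0r.
Qed.

Lemma malg_liftU k : malg_lift << k >> = h k.
Proof.
by rewrite (malg_liftEw msuppU_le) big_seq_fset1 mcoeffUU scale1r.
Qed.

Lemma malg_lift_linear : linear malg_lift.
Proof.
move=> a x y; set d := (msupp x `|` msupp y)%fset.
have dx : (msupp x `<=` d)%fset by apply: fsubsetUl.
have dy : (msupp y `<=` d)%fset by apply: fsubsetUr.
have dxy : (msupp (a *: x + y) `<=` d)%fset.
  apply: (fsubset_trans (msuppD_le _ _)); apply: fsetUSS => //.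
  exact: msuppZ_le.
rewrite (malg_liftEw dx) (malg_liftEw dy) (malg_liftEw dxy).
rewrite scaler_sumr -big_split /=; apply: eq_bigr => k _.
by rewrite mcoeffD mcoeffZ scalerDl scalerA.
Qed.

HB.instance Definition _ := GRing.isLinear.Build R {malg R[K]} W *:%R malg_lift
  malg_lift_linear.

End FreeModule.

(* M (x)_R N is the free R-module on M * N modulo the bilinearity relations. *)
Section Tensor.
Variables (R : comNzRingType) (M N : lmodType R).

Definition tensor_rel : set {malg R[(M * N)%type]} :=
  [set x | exists a u v n, x = << (a *: u + v, n) >>
                               - (a *: << (u, n) >> + << (v, n) >>)] `|`
  [set x | exists a m u v, x = << (m, a *: u + v) >>
                               - (a *: << (m, u) >> + << (m, v) >>)].

Definition tensor : Type := lquot (span tensor_rel).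
HB.instance Definition _ := GRing.Lmodule.on tensor.

Definition tens (x : M) (y : N) : tensor := lpi _ << (x, y) >>.

Lemma tens_linearl a u v y : tens (a *: u + v) y = a *: tens u y + tens v y.
Proof.
rewrite /tens -linearP; apply/lpiE; apply: sub_span; left.
by exists a, u, v, y.
Qed.

Lemma tens_linearr a x u v : tens x (a *: u + v) = a *: tens x u + tens x v.
Proof.
rewrite /tens -linearP; apply/lpiE; apply: sub_span; right.
by exists a, x, u, v.
Qed.

Lemma tensor_ind (P : tensor -> Prop) :
  P 0 -> (forall a x y t, P t -> P (a *: tens x y + t)) -> forall t, P t.
Proof.
move=> P0 PS t; have [g <-] := lpi_surj t.
rewrite [g]monalgE; elim: (enum_fset _) => [|k s IH].
  by rewrite big_nil raddf0.
rewrite big_cons raddfD /=; set w := (X in P (_ + X)).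
suff -> : lpi (span tensor_rel) << g@_k *g k >> = g@_k *: tens k.1 k.2.
  exact: PS.
rewrite /tens -linearZ; congr lpi; apply/malgP => l.
by rewrite mcoeffZ !mcoeffU -surjective_pairing mulr_natr.
Qed.

Section Lift.
Variables (W : lmodType R) (f : M -> N -> W).
Hypothesis fl : forall a u v y, f (a *: u + v) y = a *: f u y + f v y.
Hypothesis fr : forall a x u v, f x (a *: u + v) = a *: f x u + f x v.

Definition tensor_lift : tensor -> W :=
  lquot_lift (malg_lift (fun p => f p.1 p.2)).

Lemma tensor_lift0 x : span tensor_rel x ->
  malg_lift (fun p => f p.1 p.2) x = 0.
Proof.
move=> Sx; apply: (Sx [set z | malg_lift _ z = 0]) => [|y].
  split; first exact: raddf0.
  by move=> a u v /= u0 v0; rewrite linearP /= u0 v0 scaler0 addr0.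
by case=> [[a [u [v [n ->]]]]|[a [m [u [v ->]]]]];
   rewrite /= linearB linearP /= !malg_liftU /= ?fl ?fr subrr.
Qed.

Lemma tensor_liftE x y : tensor_lift (tens x y) = f x y.
Proof. by rewrite /tensor_lift /tens (lquot_liftE tensor_lift0) /= malg_liftU. Qed.

Lemma tensor_lift_linear : linear tensor_lift.
Proof. exact: (lquot_lift_linear tensor_lift0). Qed.

End Lift.
End Tensor.

Local Opaque tens tensor_lift.

(* The A-module M (x)_R A: an alias of [tensor M A], which already carries its
   R-module structure. *)
Section BaseChange.
Variables (R : comNzRingType) (M : lmodType R) (A : comAlgType R).

Definition base_change : Type := tensor M A.
HB.instance Definition _ := GRing.Zmodule.on base_change.

Let act (a : A) (x : M) (b : A) : tensor M A := tens x (a * b).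

Let act_l a c u v b : act a (c *: u + v) b = c *: act a u b + act a v b.
Proof. exact: tens_linearl. Qed.

Let act_r a c x u v : act a x (c *: u + v) = c *: act a x u + act a x v.
Proof. by rewrite /act mulrDr -scalerAr tens_linearr. Qed.

Definition bc_scale (a : A) (t : base_change) : base_change :=
  tensor_lift (act a) t.

Let bc_scaleE a x b : bc_scale a (tens x b) = tens x (a * b).
Proof. exact: (tensor_liftE (act_l a) (act_r a)). Qed.

Let bc_scaleP a c (t s : tensor M A) :
  bc_scale a (c *: t + s) = c *: (bc_scale a t : tensor M A) + bc_scale a s.
Proof. exact: (tensor_lift_linear (act_l a) (act_r a)). Qed.

Let bc_scale0 a : bc_scale a (0 : tensor M A) = 0.
Proof.
have := bc_scaleP a (-1) 0 0.
by rewrite scaler0 addr0 scaleN1r addNr.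
Qed.

Local Opaque bc_scale.

Lemma bc_scaleA a b t : bc_scale a (bc_scale b t) = bc_scale (a * b) t.
Proof.
elim/tensor_ind: t => [|c x y t IH]; first by rewrite !bc_scale0.
by rewrite !bc_scaleP IH !bc_scaleE mulrA.
Qed.

Lemma bc_scale1 : left_id 1 bc_scale.
Proof.
move=> t; elim/tensor_ind: t => [|c x y t IH]; first by rewrite !bc_scale0.
by rewrite !bc_scaleP IH !bc_scaleE mul1r.
Qed.

Lemma bc_scaleDr : right_distributive bc_scale +%R.
Proof.
move=> a t s; have := bc_scaleP a 1 t s.
by rewrite !scale1r.
Qed.

Lemma bc_scaleDl t : {morph bc_scale^~ t : a b / a + b}.
Proof.
move=> a b; elim/tensor_ind: t => [|c x y t IH].
  by rewrite !bc_scale0 addr0.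
rewrite !bc_scaleP IH !bc_scaleE mulrDl.
have := tens_linearr 1 x (a * y) (b * y); rewrite !scale1r => ->.
by rewrite scalerDr addrACA.
Qed.

HB.instance Definition _ := GRing.Zmodule_isLmodule.Build A base_change
  bc_scaleA bc_scale1 bc_scaleDr bc_scaleDl.

End BaseChange.

(* (a (x) b) * (c (x) d) = ac (x) bd *)
Section TensorAlgebra.
Variables (R : comNzRingType) (A B : comAlgType R).
Local Notation T := (tensor A B).

Let tmul1 (a : A) (b : B) (c : A) (d : B) : T := tens (a * c) (b * d).

Let tmul1_l a b k u v d :
  tmul1 a b (k *: u + v) d = k *: tmul1 a b u d + tmul1 a b v d.
Proof. by rewrite /tmul1 mulrDr -scalerAr tens_linearl. Qed.

Let tmul1_r a b k c u v :
  tmul1 a b c (k *: u + v) = k *: tmul1 a b c u + tmul1 a b c v.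
Proof. by rewrite /tmul1 mulrDr -scalerAr tens_linearr. Qed.

Let tmul2 (t : T) (a : A) (b : B) : T := tensor_lift (tmul1 a b) t.

Let tmul2E c d a b : tmul2 (tens c d) a b = tens (a * c) (b * d).
Proof. exact: (tensor_liftE (tmul1_l a b) (tmul1_r a b)). Qed.

Let tmul2P k t s a b : tmul2 (k *: t + s) a b = k *: tmul2 t a b + tmul2 s a b.
Proof. exact: (tensor_lift_linear (tmul1_l a b) (tmul1_r a b)). Qed.

Let tmul20 a b : tmul2 0 a b = 0.
Proof.
have := tmul2P (-1) 0 0 a b.
by rewrite scaler0 addr0 scaleN1r addNr.
Qed.

Let scalerAC (k l : R) (t : T) : k *: (l *: t) = l *: (k *: t).
Proof. by rewrite !scalerA mulrC. Qed.

Let tmul2_l t k u v b : tmul2 t (k *: u + v) b = k *: tmul2 t u b + tmul2 t v b.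
Proof.
elim/tensor_ind: t => [|l c d t IH]; first by rewrite !tmul20 scaler0 addr0.
rewrite !tmul2P IH !tmul2E mulrDl -scalerAl tens_linearl !scalerDr.
by rewrite [l *: (k *: _)]scalerAC addrACA.
Qed.

Let tmul2_r t k a u v : tmul2 t a (k *: u + v) = k *: tmul2 t a u + tmul2 t a v.
Proof.
elim/tensor_ind: t => [|l c d t IH]; first by rewrite !tmul20 scaler0 addr0.
rewrite !tmul2P IH !tmul2E mulrDl -scalerAl tens_linearr !scalerDr.
by rewrite [l *: (k *: _)]scalerAC addrACA.
Qed.

Definition tensor_mul (s t : T) : T := tensor_lift (tmul2 t) s.

Lemma tensor_mulE a b c d :
  tensor_mul (tens a b) (tens c d) = tens (a * c) (b * d).
Proof.
by rewrite /tensor_mul (tensor_liftE (tmul2_l _) (tmul2_r _)) tmul2E.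
Qed.

Let tmulPl k s s' t :
  tensor_mul (k *: s + s') t = k *: tensor_mul s t + tensor_mul s' t.
Proof. exact: (tensor_lift_linear (tmul2_l t) (tmul2_r t)). Qed.

Let tmul0l t : tensor_mul 0 t = 0.
Proof.
have := tmulPl (-1) 0 0 t.
by rewrite scaler0 addr0 scaleN1r addNr.
Qed.

Let tmulEl a b t : tensor_mul (tens a b) t = tmul2 t a b.
Proof. exact: (tensor_liftE (tmul2_l _) (tmul2_r _)). Qed.

Let tmulPr k s t t' :
  tensor_mul s (k *: t + t') = k *: tensor_mul s t + tensor_mul s t'.
Proof.
elim/tensor_ind: s => [|l a b s IH]; first by rewrite !tmul0l scaler0 addr0.
rewrite !tmulPl IH !tmulEl tmul2P !scalerDr.
by rewrite [l *: (k *: _)]scalerAC addrACA.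
Qed.

Let tmul0r s : tensor_mul s 0 = 0.
Proof.
have := tmulPr (-1) s 0 0.
by rewrite scaler0 addr0 scaleN1r addNr.
Qed.

Local Opaque tensor_mul.

Lemma tensor_mulA : associative tensor_mul.
Proof.
move=> s t u; elim/tensor_ind: s => [|l a b s IH]; first by rewrite !tmul0l.
rewrite !tmulPl -{}IH; congr (_ *: _ + _).
elim/tensor_ind: t => [|l' c d t IH]; first by rewrite !(tmul0l, tmul0r).
rewrite tmulPl !tmulPr tmulPl {}IH; congr (_ *: _ + _).
elim/tensor_ind: u => [|l'' e f u IH]; first by rewrite !(tmul0l, tmul0r).
by rewrite !tmulPr {}IH !tensor_mulE !mulrA.
Qed.

Lemma tensor_mulC : commutative tensor_mul.
Proof.
move=> s t; elim/tensor_ind: s => [|l a b s IH]; first by rewrite tmul0l tmul0r.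
rewrite tmulPl tmulPr {}IH; congr (_ *: _ + _).
elim/tensor_ind: t => [|l' c d t IH]; first by rewrite tmul0l tmul0r.
by rewrite tmulPl tmulPr {}IH !tensor_mulE (mulrC a) (mulrC b).
Qed.

Lemma tensor_mul1 : left_id (tens 1 1) tensor_mul.
Proof.
move=> t; elim/tensor_ind: t => [|l a b s IH]; first by rewrite tmul0r.
by rewrite tmulPr {}IH tensor_mulE !mul1r.
Qed.

Lemma tensor_mulDl : left_distributive tensor_mul +%R.
Proof. by move=> s t u; have := tmulPl 1 s t u; rewrite !scale1r. Qed.

HB.instance Definition _ := GRing.Zmodule_isComPzRing.Build T
  tensor_mulA tensor_mulC tensor_mul1 tensor_mulDl.

End TensorAlgebra.

Section AlgebraQuotient.
Variables (R : comNzRingType) (A : comAlgType R) (I : idealr A).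

Definition alg_quot : Type := {ideal_quot I}.
HB.instance Definition _ := GRing.ComNzRing.on alg_quot.

Definition api : A -> alg_quot := \pi_alg_quot.

Lemma apiE x y : (api x = api y) <-> (x - y \in I).
Proof.
rewrite /api; split=> [/eqP|xy]; first by rewrite -Quotient.idealrBE.
by apply/eqP; rewrite -Quotient.idealrBE.
Qed.

Lemma api_surj (x : alg_quot) : exists a, api a = x.
Proof. by exists (repr x); apply: reprK. Qed.

Lemma api_zmod : zmod_morphism api.
Proof. by move=> x y; rewrite /api /= !piE. Qed.

Lemma api_monoid : monoid_morphism api.
Proof. by split=> [|x y]; rewrite /api /= !piE. Qed.

HB.instance Definition _ := GRing.isZmodMorphism.Build A alg_quot api api_zmod.
HB.instance Definition _ :=
  GRing.isMonoidMorphism.Build A alg_quot api api_monoid.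

Definition alg_quot_scale (r : R) : alg_quot -> alg_quot :=
  lift_op1 alg_quot (GRing.scale r).

Lemma alg_quot_scaleE r a : alg_quot_scale r (api a) = api (r *: a).
Proof.
rewrite /alg_quot_scale; unlock; apply/apiE; rewrite -scalerBr -mulr_algl.
by apply: idealMr; apply/apiE/reprK.
Qed.

Lemma alg_quot_scaleA r s x :
  alg_quot_scale r (alg_quot_scale s x) = alg_quot_scale (r * s) x.
Proof. by have [a <-] := api_surj x; rewrite !alg_quot_scaleE scalerA. Qed.

Lemma alg_quot_scale1 : left_id 1 alg_quot_scale.
Proof.
by move=> x; have [a <-] := api_surj x; rewrite alg_quot_scaleE scale1r.
Qed.

Lemma alg_quot_scaleDr : right_distributive alg_quot_scale +%R.
Proof.
move=> r x y; have [a <-] := api_surj x; have [b <-] := api_surj y.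
by rewrite -raddfD !alg_quot_scaleE scalerDr raddfD.
Qed.

Lemma alg_quot_scaleDl x : {morph alg_quot_scale^~ x : r s / r + s}.
Proof.
move=> r s; have [a <-] := api_surj x.
by rewrite !alg_quot_scaleE scalerDl raddfD.
Qed.

HB.instance Definition _ := GRing.Zmodule_isLmodule.Build R alg_quot
  alg_quot_scaleA alg_quot_scale1 alg_quot_scaleDr alg_quot_scaleDl.

Lemma apiZ : scalable api.
Proof. by move=> r a; rewrite -alg_quot_scaleE. Qed.
HB.instance Definition _ := GRing.isScalable.Build R A alg_quot *:%R api apiZ.

Lemma alg_quot_scaleAl (r : R) (x y : alg_quot) : r *: (x * y) = (r *: x) * y.
Proof.
have [a <-] := api_surj x; have [b <-] := api_surj y.
by rewrite -rmorphM -!linearZ -rmorphM /= scalerAl.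
Qed.

HB.instance Definition _ :=
  GRing.Lmodule_isLalgebra.Build R alg_quot alg_quot_scaleAl.
HB.instance Definition _ := GRing.Lalgebra_isComAlgebra.Build R alg_quot.

End AlgebraQuotient.

Definition residue_field (R : comNzRingType) (m : idealr R) : comAlgType R :=
  alg_quot (m : idealr R^o).

(* Fractions x / s with s a non-zero-divisor; x / s = y / t iff x t = y s. *)
Section TotalFractions.
Variable R : comNzRingType.

Definition nzd : pred R := fun s => `[< GRing.lreg s >].

Record nzd_frac := NzdFrac { frac_pair :> R * R; _ : nzd frac_pair.2 }.
HB.instance Definition _ := [isSub for frac_pair].
HB.instance Definition _ := [Choice of nzd_frac by <:].

Lemma nzd_fracP (f : nzd_frac) : GRing.lreg f.2.
Proof. exact/asboolP/(valP f). Qed.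

Lemma nzd1 : nzd 1. Proof. exact/asboolP/lreg1. Qed.

Lemma nzdM s t : nzd s -> nzd t -> nzd (s * t).
Proof. by move=> /asboolP rs /asboolP rt; apply/asboolP/lregM. Qed.

Definition frac_eqv : rel nzd_frac := fun f g => f.1 * g.2 == g.1 * f.2.

Lemma frac_eqv_equiv : equiv_class_of frac_eqv.
Proof.
split=> [f|f g|g f h] //; first exact: eqxx.
  by rewrite /frac_eqv eq_sym.
rewrite /frac_eqv => /eqP fg /eqP gh; apply/eqP.
apply: (@nzd_fracP g).
transitivity ((f.1 * g.2) * h.2); first by ring.
by rewrite fg; transitivity ((g.1 * h.2) * f.2); [ring|rewrite gh; ring].
Qed.

Canonical frac_eqv_rel := EquivRelPack frac_eqv_equiv.

Definition total_frac : Type := {eq_quot frac_eqv}.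
HB.instance Definition _ := EqQuotient.on total_frac.
HB.instance Definition _ := Choice.on total_frac.

Definition tfrac (x s : R) (hs : nzd s) : total_frac :=
  \pi_total_frac (@NzdFrac (x, s) hs).

Lemma tfracE x y s t (hs : nzd s) (ht : nzd t) :
  (tfrac x hs = tfrac y ht) <-> x * t = y * s.
Proof.
rewrite /tfrac; split=> [/eqmodP/eqP //|xy].
exact/eqmodP/eqP.
Qed.

Lemma tfracP (q : total_frac) : exists x s (hs : nzd s), q = tfrac x hs.
Proof.
case E: (repr q) => [[x s] hs]; exists x, s, hs.
by rewrite -[q]reprK E.
Qed.

Definition tf_add (p q : total_frac) : total_frac :=
  let: NzdFrac (x, s) hs := repr p in let: NzdFrac (y, t) ht := repr q in
  tfrac (x * t + y * s) (nzdM hs ht).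

Definition tf_mul (p q : total_frac) : total_frac :=
  let: NzdFrac (x, s) hs := repr p in let: NzdFrac (y, t) ht := repr q in
  tfrac (x * y) (nzdM hs ht).

Definition tf_opp (p : total_frac) : total_frac :=
  let: NzdFrac (x, s) hs := repr p in tfrac (- x) hs.

Let repr_tfrac x s (hs : nzd s) x' s' hs' :
  repr (tfrac x hs) = @NzdFrac (x', s') hs' -> x * s' = x' * s.
Proof.
move=> E; apply/(tfracE x x' hs hs').
by rewrite /tfrac -{}E reprK.
Qed.

Lemma tf_addE x y s t (hs : nzd s) (ht : nzd t) :
  tf_add (tfrac x hs) (tfrac y ht) = tfrac (x * t + y * s) (nzdM hs ht).
Proof.
rewrite /tf_add; case E: (repr (tfrac x hs)) => [[x' s'] hs'].
case F: (repr (tfrac y ht)) => [[y' t'] ht'].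
have {E} xs := repr_tfrac E; have {F} yt := repr_tfrac F.
apply/tfracE; rewrite /= !mulrDl; congr (_ + _).
- transitivity ((x' * s) * (t' * t)); first by ring.
  by rewrite -xs; ring.
- transitivity ((y' * t) * (s' * s)); first by ring.
  by rewrite -yt; ring.
Qed.

Lemma tf_mulE x y s t (hs : nzd s) (ht : nzd t) :
  tf_mul (tfrac x hs) (tfrac y ht) = tfrac (x * y) (nzdM hs ht).
Proof.
rewrite /tf_mul; case E: (repr (tfrac x hs)) => [[x' s'] hs'].
case F: (repr (tfrac y ht)) => [[y' t'] ht'].
have {E} xs := repr_tfrac E; have {F} yt := repr_tfrac F.
apply/tfracE; rewrite /=; transitivity ((x' * s) * (y' * t)); first by ring.
by rewrite -xs -yt; ring.
Qed.

Lemma tf_oppE x s (hs : nzd s) : tf_opp (tfrac x hs) = tfrac (- x) hs.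
Proof.
rewrite /tf_opp; case E: (repr (tfrac x hs)) => [[x' s'] hs'].
by apply/tfracE; rewrite /= !mulNr (repr_tfrac E).
Qed.

Lemma tf_addA : associative tf_add.
Proof.
move=> p q r; have [x [s [hs ->]]] := tfracP p.
have [y [t [ht ->]]] := tfracP q; have [z [u [hu ->]]] := tfracP r.
by rewrite !tf_addE; apply/tfracE => /=; ring.
Qed.

Lemma tf_addC : commutative tf_add.
Proof.
move=> p q; have [x [s [hs ->]]] := tfracP p.
by have [y [t [ht ->]]] := tfracP q; rewrite !tf_addE; apply/tfracE => /=; ring.
Qed.

Lemma tf_add0 : left_id (tfrac 0 nzd1) tf_add.
Proof.
move=> p; have [x [s [hs ->]]] := tfracP p.
by rewrite tf_addE; apply/tfracE => /=; ring.
Qed.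

Lemma tf_addN : left_inverse (tfrac 0 nzd1) tf_opp tf_add.
Proof.
move=> p; have [x [s [hs ->]]] := tfracP p.
by rewrite tf_oppE tf_addE; apply/tfracE => /=; ring.
Qed.

HB.instance Definition _ :=
  GRing.isZmodule.Build total_frac tf_addA tf_addC tf_add0 tf_addN.

Lemma tf_mulA : associative tf_mul.
Proof.
move=> p q r; have [x [s [hs ->]]] := tfracP p.
have [y [t [ht ->]]] := tfracP q; have [z [u [hu ->]]] := tfracP r.
by rewrite !tf_mulE; apply/tfracE => /=; ring.
Qed.

Lemma tf_mulC : commutative tf_mul.
Proof.
move=> p q; have [x [s [hs ->]]] := tfracP p.
by have [y [t [ht ->]]] := tfracP q; rewrite !tf_mulE; apply/tfracE => /=; ring.
Qed.

Lemma tf_mul1 : left_id (tfrac 1 nzd1) tf_mul.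
Proof.
move=> p; have [x [s [hs ->]]] := tfracP p.
by rewrite tf_mulE; apply/tfracE => /=; ring.
Qed.

Lemma tf_mulDl : left_distributive tf_mul +%R.
Proof.
move=> p q r; have [x [s [hs ->]]] := tfracP p.
have [y [t [ht ->]]] := tfracP q; have [z [u [hu ->]]] := tfracP r.
change (tf_mul (tf_add (tfrac x hs) (tfrac y ht)) (tfrac z hu) =
  tf_add (tf_mul (tfrac x hs) (tfrac z hu)) (tf_mul (tfrac y ht) (tfrac z hu))).
by rewrite !(tf_mulE, tf_addE); apply/tfracE => /=; ring.
Qed.

Lemma tf_1neq0 : tfrac 1 nzd1 != 0.
Proof.
by apply/eqP => /tfracE /eqP; rewrite mulr1 mul0r oner_eq0.
Qed.

HB.instance Definition _ := GRing.Zmodule_isComNzRing.Build total_frac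
  tf_mulA tf_mulC tf_mul1 tf_mulDl tf_1neq0.

Definition tf_scale (r : R) (q : total_frac) : total_frac :=
  tfrac r nzd1 * q.

Let tf_scaleE r x s (hs : nzd s) : tf_scale r (tfrac x hs) = tfrac (r * x) hs.
Proof. by rewrite /tf_scale [LHS]tf_mulE; apply/tfracE => /=; ring. Qed.

Lemma tf_scaleA r s q : tf_scale r (tf_scale s q) = tf_scale (r * s) q.
Proof.
have [x [t [ht ->]]] := tfracP q.
by rewrite !tf_scaleE mulrA.
Qed.

Lemma tf_scale1 : left_id 1 tf_scale.
Proof. exact: mul1r. Qed.

Lemma tf_scaleDr : right_distributive tf_scale +%R.
Proof. by move=> r p q; rewrite /tf_scale mulrDr. Qed.

Lemma tf_scaleDl q : {morph tf_scale^~ q : r s / r + s}.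
Proof.
move=> r s; rewrite /tf_scale -mulrDl; congr (_ * _).
by rewrite [RHS]tf_addE; apply/tfracE => /=; ring.
Qed.

HB.instance Definition _ := GRing.Zmodule_isLmodule.Build R total_frac
  tf_scaleA tf_scale1 tf_scaleDr tf_scaleDl.

Lemma tf_scaleAl (r : R) (p q : total_frac) : r *: (p * q) = (r *: p) * q.
Proof. exact: mulrA. Qed.

HB.instance Definition _ :=
  GRing.Lmodule_isLalgebra.Build R total_frac tf_scaleAl.
HB.instance Definition _ := GRing.Lalgebra_isComAlgebra.Build R total_frac.

End TotalFractions.

Definition has_rank (R : comNzRingType) (E : lmodType R) (e : nat) : Prop :=
  exists f : {linear base_change E (total_frac R) -> 'rV[total_frac R]_e},
    bijective f.

(* The e-th exterior power is the free R-module on E^e modulo multilinearity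
   and the vanishing of tuples with a repeated entry. *)
Section ExteriorPower.
Variables (R : comNzRingType) (E : lmodType R) (e : nat).

Definition subst (x : {ffun 'I_e -> E}) (i : 'I_e) (u : E) :
  {ffun 'I_e -> E} := [ffun j => if j == i then u else x j].

Definition ext_rel : set {malg R[{ffun 'I_e -> E}]} :=
  [set w | exists x i a u v,
     w = << subst x i (a *: u + v) >>
         - (a *: << subst x i u >> + << subst x i v >>)] `|`
  [set w | exists (x : {ffun 'I_e -> E}) i j,
     [/\ i != j, x i = x j & w = << x >>]].

Definition ext_power : lmodType R := lquot (span ext_rel).

End ExteriorPower.

Lemma mcoeff_lin0 (R : comNzRingType) (K : choiceType) (k : K) (a : R)
    (x y z : {malg R[K]}) :
  x@_k = 0 -> y@_k = 0 -> z@_k = 0 -> (x - (a *: y + z))@_k = 0.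
Proof.
by move=> x0 y0 z0; rewrite mcoeffB mcoeffD mcoeffZ x0 y0 z0 mulr0 addr0 subr0.
Qed.

(* The symmetric algebra is the polynomial R-algebra with one variable [sym_var]
   per element of M, modulo the R-linearity of [sym_var]. *)
Section ReesAlgebra.
Variables (R : comNzRingType) (M : lmodType R).

Local Notation P := {malg R[{cmonom M}]}.

Definition sym_var (x : M) : P := << ucm x >>.

Definition sym_rel : set P :=
  [set w | exists a u v,
     w = sym_var (a *: u + v) - (a *: sym_var u + sym_var v)].

Definition sym_ideal : {pred P} := fun w => `[< ideal_span sym_rel w >].

Lemma sym_var_coeff1 x : (sym_var x)@_(mone : {cmonom M}) = 0.
Proof. by rewrite mcoeffU1 cm1_eq1. Qed.

Local Opaque sym_var.

Lemma sym_ideal_coeff1 w : ideal_span sym_rel w -> w@_(mone : {cmonom M}) = 0.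
Proof.
move=> Sw; apply: (Sw [set w | mcoeff mone w = 0]) => [|z].
  split=> [|a x y /= x0 y0]; first exact: mcoeff0.
  rewrite mcoeffD y0 addr0.
  have [-> _] := @mcoeff1g_is_multiplicative {cmonom M} R.
  by rewrite x0 mulr0.
case=> a [u [v ->]] /=.
by apply: mcoeff_lin0; apply: sym_var_coeff1.
Qed.

Lemma sym_ideal_closed : idealr_closed sym_ideal.
Proof.
have [I0 IL] := ideal_spanP sym_rel; split.
- exact/asboolP.
- apply/negP => /asboolP/sym_ideal_coeff1/eqP.
  by rewrite mcoeff1 eqxx oner_eq0.
- by move=> a x y /asboolP hx /asboolP hy; apply/asboolP; exact: IL.
Qed.

HB.instance Definition _ := isIdealr.Build P sym_ideal sym_ideal_closed.

Definition sym_alg : comAlgType R := alg_quot sym_ideal.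

Definition rees_ideal : {pred sym_alg} := fun x => `[< torsion x >].

Lemma rees_ideal_closed : idealr_closed rees_ideal.
Proof.
split.
- by apply/asboolP; exists 1; [apply: lreg1|rewrite scaler0].
- apply/negP => /asboolP[r rreg].
  have -> : (1 : sym_alg) = api _ 1 by rewrite rmorph1.
  rewrite -linearZ -(raddf0 (api _)) => /apiE.
  rewrite subr0 => /asboolP/sym_ideal_coeff1.
  rewrite mcoeffZ mcoeff1 eqxx mulr1 => r0.
  have /eqP : (1 : R) = 0 by apply: rreg; rewrite r0 !mul0r.
  by rewrite oner_eq0.
- move=> a x y /asboolP[r rreg rx] /asboolP[s sreg sy].
  apply/asboolP; exists (r * s); first exact: lregM.
  rewrite scalerDr -[_ *: y]scalerA sy scaler0 addr0.
  by rewrite scalerAr [r * s]mulrC -scalerA rx scaler0 mulr0.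
Qed.

HB.instance Definition _ := isIdealr.Build sym_alg rees_ideal rees_ideal_closed.

Definition rees_alg : comAlgType R := alg_quot rees_ideal.

End ReesAlgebra.

Definition analytic_spread (R : comNzRingType) (m : idealr R) (M : lmodType R) :
  \bar int := krull_dim (tensor (rees_alg M) (residue_field m)).

(* Matrices act on row vectors: [phi] is the map v |-> v *m phi, R^m -> R^n. *)
Definition is_presentation (R : comNzRingType) (M : lmodType R) (m n : nat)
    (phi : 'M[R]_(m, n)) (p : {linear 'rV[R]_n -> M}) : Prop :=
  (forall x, exists v, p v = x) /\
  (forall v, p v = 0 <-> exists u : 'rV[R]_m, v = u *m phi).

(* The k * k minors; non-injective choices of rows or columns contribute only
   zeros, and the unique 0 * 0 minor is 1. *)
Definition minors (R : comNzRingType) (m n k : nat) (phi : 'M[R]_(m, n)) :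
  set R := [set d | exists (f : 'I_k -> 'I_m) (g : 'I_k -> 'I_n),
                      d = \det (mxsub f g phi)].

(* F is the i-th Fitting ideal of M, computed from some finite presentation;
   truncated subtraction gives the unit ideal for n <= i. *)
Definition is_fitting_ideal (R : comNzRingType) (M : lmodType R) (i : nat)
    (F : set R) : Prop :=
  exists (m n : nat) (phi : 'M[R]_(m, n)) (p : {linear 'rV[R]_n -> M}),
    is_presentation phi p /\ F = ideal_span (minors (n - i) phi).

Section ProjectiveDimension.
Variable R : comNzRingType.

Definition is_projective (P : lmodType R) : Prop :=
  forall (U V : lmodType R) (g : {linear U -> V}) (f : {linear P -> V}),
    (forall v, exists u, g u = v) ->
    exists h : {linear P -> U}, forall x, g (h x) = f x.

(* [proj_res n M]: M has a projective resolution
   0 -> P_n -> ... -> P_0 -> M -> 0. *)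
Inductive proj_res : nat -> lmodType R -> Prop :=
| ProjRes0 (P : lmodType R) : is_projective P -> proj_res 0 P
| ProjResS (n : nat) (K P M : lmodType R)
    (i : {linear K -> P}) (p : {linear P -> M}) :
    is_projective P -> injective i -> (forall y, exists x, p x = y) ->
    (forall x, p x = 0 <-> exists k, i k = x) ->
    proj_res n K -> proj_res n.+1 M.

(* The zero module is given projective dimension 0. *)
Definition proj_dim (M : lmodType R) : \bar int :=
  infimum +oo%E [set n%:Z%:E | n in [set n | proj_res n M]].

End ProjectiveDimension.

(* Main.v *)
(** Since proj dim E = 1, the kernel of a surjection R^n -> E is free, with basis the
    rows of an r x n matrix psi, and n = r + e. Then
    x_1 /\ ... /\ x_e |-> det (psi; lifts of the x_i) is a linear form on the exterior
    power of E whose image I contains F_e(E). It extends to a map from the symmetric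
    algebra onto R[It] which kills torsion, so the fiber cone of I is a quotient of
    the ring computing the analytic spread, and it suffices to bound ht I by the
    dimension of that cone.

    If the cone has no chain of k + 2 homogeneous primes, homogeneous prime
    avoidance gives k homogeneous elements such that every homogeneous prime
    containing them is irrelevant. Lifting them to R, some power I^N lies in
    (f_1, ..., f_k) + m I^N, and Nakayama removes the second term. A prime minimal
    over (f_1, ..., f_k) thus contains I, and it has height at most k by Krull's
    height theorem. *)

Require Import Defs.
From HB Require Import structures.
From mathcomp Require Import all_boot all_order all_algebra.
From mathcomp Require Import ring_quotient finmap monalg.
From mathcomp Require Import boolp classical_sets constructive_ereal.
From mathcomp Require Import ring.

Set Implicit Arguments.
Unset Strict Implicit.
Unset Printing Implicit Defensive.

Import Order.TTheory GRing.Theory.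

Local Open Scope classical_set_scope.
Local Open Scope ring_scope.

(** The residue field may be finite, so a reduction of [I] generated by as many elements as the
    dimension of the cone need not exist. Homogeneous elements of arbitrary positive degree take
    their place: their lifts still lie in [I], and heights only see radicals. That the projective
    dimension is 1 and not 0 puts [I] inside [m]: a unit value of the linear form would make E
    projective. This yields a prime minimal over the [f_i] inside [m], and the factor outside [m]
    that Nakayama produces stays outside that prime. The cone and the Rees algebra [R[It]] are not
    built as rings. A homogeneous ideal is a family of ideals of R, one in each [I^j], and is pulled
    back along a ring map onto [R[It]]. One such map, from a Noetherian polynomial ring, gives
    Noetherian induction; another, from the polynomial ring presenting the symmetric algebra, turns
    chains of homogeneous primes into chains of primes of the ring that defines the analytic
    spread. *)

(** * Ideals, primes and contractions from localizations *)

Section IdealTheory.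
Variable A : comPzRingType.
Implicit Types (I J P Q L : set A) (x y a b : A).

Lemma ideal0 I : is_ideal I -> I 0.
Proof. by case. Qed.

Lemma idealP I a x y : is_ideal I -> I x -> I y -> I (a * x + y).
Proof. by case=> _; apply. Qed.

Lemma idealD I x y : is_ideal I -> I x -> I y -> I (x + y).
Proof. by move=> iI Ix Iy; rewrite -[x]mul1r; apply: idealP. Qed.

Lemma idealMl I a x : is_ideal I -> I x -> I (a * x).
Proof. by move=> iI Ix; rewrite -[_ * _]addr0; apply: idealP => //; apply: ideal0. Qed.

Lemma idealMr I a x : is_ideal I -> I x -> I (x * a).
Proof. by rewrite mulrC; apply: idealMl. Qed.

Lemma idealN I x : is_ideal I -> I x -> I (- x).
Proof. by move=> iI Ix; rewrite -mulN1r; apply: idealMl. Qed.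

Lemma idealB I x y : is_ideal I -> I x -> I y -> I (x - y).
Proof. by move=> iI Ix Iy; apply: idealD => //; apply: idealN. Qed.

Lemma ideal_addr I x y : is_ideal I -> I x -> I (x + y) -> I y.
Proof. by move=> iI Ix /idealB-/(_ _ iI Ix); rewrite addrC addKr. Qed.

Lemma ideal_sum I (K : Type) (s : seq K) (Pr : pred K) (F : K -> A) :
  is_ideal I -> (forall k, Pr k -> I (F k)) -> I (\sum_(k <- s | Pr k) F k).
Proof.
move=> iI IF; elim/big_rec: _ => [|k x Pk Ix]; first exact: ideal0.
by apply: idealD => //; apply: IF.
Qed.

Lemma ideal_eq1 I x : is_ideal I -> I 1 -> I x.
Proof. by move=> iI I1; rewrite -[x]mulr1; apply: idealMl. Qed.

Lemma sub_ideal_span (X : set A) : X `<=` ideal_span X.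
Proof. by move=> x Xx I _; apply. Qed.

Lemma ideal_span_min (X : set A) I : is_ideal I -> X `<=` I -> ideal_span X `<=` I.
Proof. by move=> iI XI x; apply. Qed.

Lemma prime_ideal P : is_prime_ideal P -> is_ideal P.
Proof. by case. Qed.

Lemma primeX P x n : is_prime_ideal P -> P (x ^+ n) -> P x.
Proof.
case=> _ P1 PM; elim: n => [|n IH]; first by rewrite expr0.
by rewrite exprS => /PM[].
Qed.

Lemma primeMN P x y : is_prime_ideal P -> ~ P x -> ~ P y -> ~ P (x * y).
Proof. by case=> _ _ PM Px Py /PM[]. Qed.

Definition adjoin I a : set A := [set x | exists y r, I y /\ x = y + a * r].

Lemma adjoin_ideal I a : is_ideal I -> is_ideal (adjoin I a).
Proof.
move=> iI; split; first by exists 0, 0; split; [apply: ideal0|rewrite mulr0 addr0].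
move=> c _ _ [y [r [Iy ->]]] [z [s [Iz ->]]].
by exists (c * y + z), (c * r + s); split; [apply: idealP|ring].
Qed.

Lemma sub_adjoin I a : I `<=` adjoin I a.
Proof. by move=> x Ix; exists x, 0; rewrite mulr0 addr0. Qed.

Lemma adjoin_mem I a : is_ideal I -> adjoin I a a.
Proof. by move=> iI; exists 0, 1; rewrite mulr1 add0r; split=> //; apply: ideal0. Qed.

Lemma adjoin_min I J a : is_ideal J -> I `<=` J -> J a -> adjoin I a `<=` J.
Proof.
move=> iJ IJ Ja _ [y [r [Iy ->]]].
by apply: idealD => //; [apply: IJ|apply: idealMr].
Qed.

Lemma adjoin_proper I a : is_ideal I -> ~ I a -> I `<` adjoin I a.
Proof.
move=> iI Ia; split; first exact: sub_adjoin.
by move=> H; apply/Ia/H/adjoin_mem.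
Qed.

Definition colon I a : set A := [set r | I (a * r)].

Lemma colon_ideal I a : is_ideal I -> is_ideal (colon I a).
Proof.
move=> iI; split; first by rewrite /colon /= mulr0; apply: ideal0.
by move=> c x y Ix Iy; rewrite /colon /= mulrDr mulrCA; apply: idealP.
Qed.

Lemma nprime_witness I : is_ideal I -> ~ I 1 -> ~ is_prime_ideal I ->
  exists a b, [/\ I (a * b), ~ I a & ~ I b].
Proof.
move=> iI I1 nP; apply: contrapT => H; apply: nP; split=> // x y Ixy.
by apply: contrapT => /not_orP[nx ny]; apply: H; exists x, y.
Qed.

(** Saturated ideals are those contracted from the localization at [P], and [saturation] is
    extension followed by contraction; the localized ring itself is never formed. *)
Definition saturated P L : Prop := forall s x, ~ P s -> L (s * x) -> L x.

Definition saturation P L : set A := [set x | exists2 s, ~ P s & L (s * x)].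

Lemma saturation_ideal P L :
  is_prime_ideal P -> is_ideal L -> is_ideal (saturation P L).
Proof.
move=> pP iL; split; first by case: pP => _ P1 _; exists 1 => //; rewrite mulr0; apply: ideal0.
move=> a x y [s Ps Lx] [t Pt Ly]; exists (s * t); first exact: primeMN.
have -> : s * t * (a * x + y) = (t * a) * (s * x) + s * (t * y) by ring.
by apply: idealP => //; apply: idealMl.
Qed.

Lemma sub_saturation P L : is_prime_ideal P -> L `<=` saturation P L.
Proof. by case=> _ P1 _ x Lx; exists 1; rewrite ?mul1r. Qed.

Lemma saturation_saturated P L : is_prime_ideal P -> saturated P (saturation P L).
Proof.
move=> pP s x Ps [t Pt Lx]; exists (t * s); first exact: primeMN.
by rewrite -mulrA.
Qed.

Lemma saturationS P L L' : L `<=` L' -> saturation P L `<=` saturation P L'.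
Proof. by move=> LL x [s Ps Lx]; exists s => //; apply: LL. Qed.

End IdealTheory.

(** * The ascending chain condition and minimal primes *)

Section Noetherian.
Variable A : comPzRingType.
Hypothesis noethA : is_noetherian A.
Implicit Types (I J P Q L : set A).

Lemma ascending_sub (L : nat -> set A) : (forall n, L n `<=` L n.+1) ->
  forall m n, (m <= n)%N -> L m `<=` L n.
Proof.
move=> LS m n; elim: n => [|n IH]; first by rewrite leqn0 => /eqP->.
by rewrite leq_eqVlt => /predU1P[->//|/IH Lm]; apply: subset_trans (LS n).
Qed.

Lemma noetherian_acc (L : nat -> set A) : (forall n, is_ideal (L n)) ->
  (forall n, L n `<=` L n.+1) -> exists N, forall n, L n `<=` L N.
Proof.
move=> iL LS; have mono := ascending_sub LS.
pose U : set A := [set x | exists n, L n x].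
have iU : is_ideal U.
  split; first by exists 0; apply: ideal0.
  move=> a x y [i Lx] [j Ly]; exists (maxn i j); apply: idealP => //.
    by apply: mono Lx; rewrite leq_maxl.
  by apply: mono Ly; rewrite leq_maxr.
have [s Us] := noethA iU.
have [N sN] : exists N, [set` s] `<=` L N.
  have: [set` s] `<=` U by rewrite Us; apply: sub_ideal_span.
  elim: s {Us} => [|x s IH] sU; first by exists 0.
  have [N sN] : exists N, [set` s] `<=` L N.
    by apply: IH => y ys; apply: sU; rewrite /= inE ys orbT.
  have [M xM] := sU x (mem_head _ _).
  exists (maxn N M) => y /=; rewrite inE => /predU1P[->|ys].
    by apply: mono xM; rewrite leq_maxr.
  by apply: (mono N); [rewrite leq_maxl|apply: sN].
exists N => n x Lx; apply: (ideal_span_min (iL N) sN).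
by rewrite -Us; exists n.
Qed.

Lemma noetherian_ind (Pr : set A -> Prop) :
  (forall I, is_ideal I -> (forall J, is_ideal J -> I `<` J -> Pr J) -> Pr I) ->
  forall I, is_ideal I -> Pr I.
Proof.
move=> PrS I iI; apply: contrapT => nI.
pose T := {I : set A | is_ideal I /\ ~ Pr I}.
have next (u : T) : exists v : T, sval u `<` sval v.
  case: u => J [iJ nJ] /=; apply: contrapT => H; apply: nJ; apply: PrS => // K iK JK.
  apply: contrapT => nK; apply: H.
  by exists (exist _ K (conj iK nK)).
have [f fP] := choice next.
pose L n := sval (iter n f (exist _ I (conj iI nI))).
have LP n : L n `<` L n.+1 by apply: fP.
have [|n|N LN] := @noetherian_acc L.
- by move=> n; rewrite /L; case: (iter _ _ _) => ? [].
- by case: (LP n).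
- by case: (LP N) => _; apply; apply: LN.
Qed.

Lemma noetherian_max (Fam : set (set A)) I :
  (forall J, Fam J -> is_ideal J) -> Fam I ->
  exists J, [/\ Fam J, I `<=` J & forall K, Fam K -> J `<=` K -> K = J].
Proof.
move=> FI FamI; have iI := FI _ FamI; move: I iI FamI.
apply: noetherian_ind => I iI IH FamI.
have [[K [FK IK]]|H] := pselect (exists K, Fam K /\ I `<` K).
  have [J [FJ KJ mJ]] := IH K (FI _ FK) IK FK.
  by exists J; split=> //; apply: subset_trans KJ; case: IK.
exists I; split=> // K FK IK; rewrite eqEsubset; split=> //.
by apply: contrapT => nKI; apply: H; exists K.
Qed.

(** If [a b] lies in [I] but neither factor does, every prime over [I] contains [a] or [b], so the
    lists for [I + (a)] and [I + (b)] together serve for [I]. *)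
Lemma primes_over I : is_ideal I ->
  exists2 Qs : seq (set A), (forall Q, List.In Q Qs -> is_prime_ideal Q /\ I `<=` Q) &
    forall P, is_prime_ideal P -> I `<=` P -> exists2 Q, List.In Q Qs & Q `<=` P.
Proof.
move: I; apply: noetherian_ind => I iI IH.
have [pI|npI] := pselect (is_prime_ideal I).
  exists [:: I] => [Q [<-|[]]|P pP IP]; first by split.
  by exists I => //; left.
have [I1|nI1] := pselect (I 1).
  exists [::] => // P [_ P1 _] IP; case: P1; exact: IP.
have [a [b [Iab nIa nIb]]] := nprime_witness iI nI1 npI.
have [Qs QsP Qsmin] := IH _ (adjoin_ideal a iI) (adjoin_proper iI nIa).
have [Rs RsP Rsmin] := IH _ (adjoin_ideal b iI) (adjoin_proper iI nIb).
exists (Qs ++ Rs) => [Q /List.in_app_iff[/QsP|/RsP] [pQ IQ]|P pP IP].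
- by split=> // x Ix; apply/IQ/sub_adjoin.
- by split=> // x Ix; apply/IQ/sub_adjoin.
have [iP _ PM] := pP; have [Pa|Pb] := PM a b (IP _ Iab).
  have [Q QQs QP] := Qsmin P pP (adjoin_min iP IP Pa).
  by exists Q => //; apply/List.in_app_iff; left.
have [Q QRs QP] := Rsmin P pP (adjoin_min iP IP Pb).
by exists Q => //; apply/List.in_app_iff; right.
Qed.

Definition minimal_over I P : Prop :=
  [/\ is_prime_ideal P, I `<=` P
    & forall Q, is_prime_ideal Q -> I `<=` Q -> Q `<=` P -> Q = P].

(** Every prime over [I] contains a member of the list of [primes_over], so a minimal member of that
    list below [P] is minimal over [I]. *)
Lemma minimal_prime I P : is_ideal I -> is_prime_ideal P -> I `<=` P ->
  exists2 Q, minimal_over I Q & Q `<=` P.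
Proof.
move=> iI pP IP; have [Qs QsP Qsmin] := primes_over iI.
suff [Q [QQs QP Qm]] : exists Q, [/\ List.In Q Qs, Q `<=` P &
    forall Q', List.In Q' Qs -> Q' `<=` Q -> Q' = Q].
  have [pQ IQ] := QsP _ QQs; exists Q => //; split=> // Q' pQ' IQ' Q'Q.
  have [Q2 Q2s Q2Q'] := Qsmin _ pQ' IQ'.
  rewrite eqEsubset; split=> //.
  by rewrite -(Qm Q2 Q2s (subset_trans Q2Q' Q'Q)).
have [Q0] := Qsmin P pP IP; elim: Qs Q0 {QsP Qsmin} => // Q1 Qs IH Q0.
have [[Q2 [Q2Qs Q2P]] _|H] :=
    pselect (exists Q, List.In Q Qs /\ Q `<=` P).
  have [Q [QQs QP Qm]] := IH _ Q2Qs Q2P.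
  have [Q1Q|nQ1Q] := pselect (Q1 `<=` Q).
    exists Q1; split; [by left|exact: subset_trans QP|move=> Q' [->//|Q's] Q'Q1].
    have E := Qm _ Q's (subset_trans Q'Q1 Q1Q).
    by rewrite eqEsubset; split=> //; rewrite E.
  by exists Q; split=> //; [right|move=> Q' [<-//|]; apply: Qm].
case=> [->|Q0s] Q0P; last by case: H; exists Q0.
exists Q0; split=> // [|Q' [->//|Q's] Q'Q0]; first by left.
by case: H; exists Q'; split=> //; apply: subset_trans Q0P.
Qed.

End Noetherian.

(** * Products of ideals and Nakayama's lemma *)

Section Nakayama.
Variable A : comNzRingType.
Implicit Types (I J P Q L M B : set A).

Definition ideal_mul I J : set A :=
  ideal_span [set z | exists x y, [/\ I x, J y & z = x * y]].

Lemma ideal_mul_mem I J x y : I x -> J y -> ideal_mul I J (x * y).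
Proof. by move=> Ix Jy; apply: sub_ideal_span; exists x, y. Qed.

Lemma span_seq_combination (s : seq A) :
  ideal_span [set` s] `<=`
  [set x | exists c : 'I_(size s) -> A, x = \sum_i c i * s`_i].
Proof.
apply: ideal_span_min => [|x xs /=]; first split.
- by exists (fun=> 0); rewrite big1 // => i _; rewrite mul0r.
- move=> a _ _ [c ->] [d ->]; exists (fun i => a * c i + d i).
  by rewrite mulr_sumr -big_split; apply: eq_bigr => i _ /=; ring.
have ix : (index x s < size s)%N by rewrite index_mem.
exists (fun i => (i == Ordinal ix)%:R); rewrite (bigD1 (Ordinal ix)) //= eqxx mul1r nth_index //.
by rewrite big1 ?addr0 // => i /negPf->; rewrite mul0r.
Qed.

Lemma ideal_mul_combination B (s : seq A) : is_ideal B ->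
  ideal_mul B (ideal_span [set` s]) `<=`
  [set x | exists2 b : 'I_(size s) -> A, (forall i, B (b i)) & x = \sum_i b i * s`_i].
Proof.
move=> iB; apply: ideal_span_min => [|_ [b [x [Bb /span_seq_combination[c ->] ->]]]].
  split; first by exists (fun=> 0) => [i|]; [apply: ideal0|rewrite big1 // => i _; rewrite mul0r].
  move=> a _ _ [c Bc ->] [d Bd ->]; exists (fun i => a * c i + d i).
    by move=> i; apply: idealP.
  by rewrite mulr_sumr -big_split; apply: eq_bigr => i _ /=; ring.
exists (fun i => b * c i) => [i|]; first exact: idealMr.
by rewrite mulr_sumr; apply: eq_bigr => i _; rewrite mulrA.
Qed.

Lemma prod_congr_ideal I (K : Type) (s : seq K) (F G : K -> A) : is_ideal I ->
  (forall k, I (F k - G k)) -> I (\prod_(k <- s) F k - \prod_(k <- s) G k).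
Proof.
move=> iI FG; elim: s => [|k s IH]; first by rewrite !big_nil subrr; apply: ideal0.
rewrite !big_cons; set x := \prod_(_ <- _) _ in IH *; set y := \prod_(_ <- _) _ in IH *.
have -> : F k * x - G k * y = F k * (x - y) + (F k - G k) * y by ring.
by apply: idealP => //; apply: idealMr.
Qed.

Lemma det_congr_ideal I n (M N : 'M[A]_n) : is_ideal I ->
  (forall i j, I (M i j - N i j)) -> I (\det M - \det N).
Proof.
move=> iI MN; rewrite /determinant -sumrB; apply: ideal_sum => // s _.
by rewrite -mulrBr; apply: idealMl => //; apply: prod_congr_ideal.
Qed.

Lemma prime_prod P (K : Type) (s : seq K) (F : K -> A) : is_prime_ideal P ->
  (forall k, ~ P (F k)) -> ~ P (\prod_(k <- s) F k).
Proof.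
move=> pP FP; elim/big_rec: _ => [|k x _ Px]; first by case: pP.
exact: primeMN.
Qed.

(* The adjugate trick: if [t_i s_i = y_i + \sum_j b_ij s_j] then the determinant
   of [diag t - b] multiplies every [s_i] into [L], and it is congruent to the
   product of the [t_i] modulo [P]. *)
Lemma nakayama P M L B (s : seq A) :
  is_prime_ideal P -> is_ideal L -> is_ideal B -> B `<=` P ->
  M = ideal_span [set` s] ->
  (forall x, M x -> exists t y z, [/\ ~ P t, L y, ideal_mul B M z & t * x = y + z]) ->
  exists2 t, ~ P t & forall x, M x -> L (t * x).
Proof.
move=> pP iL iB BP -> H; have iP := prime_ideal pP.
have sM (i : 'I_(size s)) : ideal_span [set` s] s`_i.
  by apply: sub_ideal_span => /=; apply: mem_nth.
have {H} step (i : 'I_(size s)) : exists tyb : A * A * ('I_(size s) -> A),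
    [/\ ~ P tyb.1.1, L tyb.1.2, forall j, B (tyb.2 j) &
        tyb.1.1 * s`_i = tyb.1.2 + \sum_j tyb.2 j * s`_j].
  have [t [y [z [Pt Ly /(ideal_mul_combination iB)[b Bb ->] E]]]] := H _ (sM i).
  by exists (t, y, b).
have [f fP] := choice step.
pose D := \matrix_(i, j) (((f i).1.1 *+ (i == j)) - (f i).2 j).
pose v : 'cV[A]_(size s) := \col_i s`_i.
pose w : 'cV[A]_(size s) := \col_i (f i).1.2.
have Dv : D *m v = w.
  apply/colP => i; rewrite !mxE.
  under eq_bigr do rewrite !mxE mulrBl.
  rewrite sumrB (bigD1 i) //= eqxx mulr1n [X in _ + X - _]big1 => [|j]; last first.
    by rewrite eq_sym => /negPf->; rewrite mulr0n mul0r.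
  by rewrite addr0; case: (fP i) => _ _ _ ->; rewrite addrK.
exists (\det D) => [PD|x /span_seq_combination[c ->]]; last first.
  rewrite mulr_sumr; apply: ideal_sum => // i _; rewrite mulrCA; apply: idealMl => //.
  have -> : \det D * s`_i = ((\adj D *m D) *m v) i 0.
    by rewrite mul_adj_mx mul_scalar_mx !mxE.
  rewrite -mulmxA Dv mxE; apply: ideal_sum => // j _; apply: idealMl => //.
  by rewrite mxE; case: (fP j).
apply: (@prime_prod P _ (index_enum 'I_(size s)) (fun i => (f i).1.1) pP).
  by move=> i; case: (fP i).
pose T := diag_mx (\row_i (f i).1.1).
have -> : \prod_i (f i).1.1 = \det T.
  by rewrite det_diag; apply: eq_bigr => i _; rewrite mxE.
have : P (\det T - \det D).
  apply: det_congr_ideal => // i j; rewrite !mxE.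
  by rewrite opprB addrCA subrr addr0; apply: BP; case: (fP i).
by move=> PTD; rewrite -[\det T](subrK (\det D)); apply: idealD.
Qed.

End Nakayama.

(** * Krull's height theorem *)

Section Krull.
Variable A : comNzRingType.
Hypothesis noethA : is_noetherian A.
Implicit Types (I J P Q L : set A).

(* Noetherian induction on [I]: if [a b] lies in [I] but neither factor does, a
   chain above [I] is controlled by its sum with [(a)] and its colon by [a]. *)
Lemma saturated_dcc J P : is_prime_ideal P -> is_ideal J ->
  (forall Q, is_prime_ideal Q -> J `<=` Q -> Q `<=` P -> Q = P) ->
  forall L : nat -> set A, (forall n, is_ideal (L n)) -> (forall n, saturated P (L n)) ->
  (forall n, J `<=` L n) -> (forall n, L n.+1 `<=` L n) ->
  exists N, forall n, (N <= n)%N -> L N `<=` L n.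
Proof.
move=> pP iJ onlyP L iL satL JL decL.
suff dcc I : is_ideal I -> J `<=` I -> forall L : nat -> set A,
    (forall n, is_ideal (L n)) -> (forall n, saturated P (L n)) ->
    (forall n, I `<=` L n) -> (forall n, L n.+1 `<=` L n) ->
    exists N, forall n, (N <= n)%N -> L N `<=` L n by exact: (dcc J).
move: I {L iL satL JL decL}; apply: noetherian_ind => // I iI IH JI L iL satL IL decL.
have mono m n : (m <= n)%N -> L n `<=` L m.
  elim: n => [|n IHn]; first by rewrite leqn0 => /eqP->.
  by rewrite leq_eqVlt => /predU1P[->//|/IHn]; apply: subset_trans.
have L1 n s : ~ P s -> L n s -> forall x, L n x.
  by move=> Ps Lns x; apply: (satL n s) => //; apply: idealMr.
have [IP|] := pselect (I `<=` P); last first.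
  move=> /existsNP[s /not_implyP[Is nPs]]; exists 0%N => n _ x _.
  by apply: (L1 n s) => //; apply: IL.
have [pI|npI] := pselect (is_prime_ideal I).
  (* Here [I] is [P], so every saturated [L n] is [P] or the unit ideal. *)
  have EI := onlyP I pI JI IP.
  have [all1|/existsNP[N LN1]] := pselect (forall n, L n 1).
    by exists 0%N => n _ x _; apply: ideal_eq1.
  exists N => n _ x LNx; apply: IL; rewrite EI.
  by apply: contrapT => /(L1 N x)/(_ LNx 1).
have nI1 : ~ I 1 by case: pP => _ P1 _ /IP.
have [a [b [Iab nIa nIb]]] := nprime_witness iI nI1 npI.
have cI : I `<` colon I a.
  split=> [x Ix|H]; first exact: idealMl.
  exact/nIb/H.
have [N1 stab1] : exists N, forall n, (N <= n)%N ->
    saturation P (adjoin (L N) a) `<=` saturation P (adjoin (L n) a).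
  apply: (IH (adjoin I a)) => [|||n|n|n|n].
  - exact: adjoin_ideal.
  - exact: adjoin_proper.
  - exact/(subset_trans JI)/sub_adjoin.
  - exact/saturation_ideal/adjoin_ideal.
  - exact: saturation_saturated.
  - apply: subset_trans (sub_saturation pP).
    apply: adjoin_min; [exact: adjoin_ideal| |exact: adjoin_mem].
    exact: subset_trans (@sub_adjoin _ _ _).
  - apply: saturationS; apply: adjoin_min; [exact: adjoin_ideal| |exact: adjoin_mem].
    exact: subset_trans (@sub_adjoin _ _ _).
have [N2 stab2] : exists N, forall n, (N <= n)%N -> colon (L N) a `<=` colon (L n) a.
  apply: (IH (colon I a)) => [|||n|n|n|n].
  - exact: colon_ideal.
  - by [].
  - by apply: subset_trans JI _; case: cI.
  - exact: colon_ideal.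
  - by move=> s x Ps; rewrite /colon /= mulrCA; apply: satL.
  - by move=> x; apply: IL.
  - by move=> x; apply: decL.
exists (maxn N1 N2) => n; rewrite geq_max => /andP[N1n N2n] x Lx.
(* Modular law: [s x = y + a r] with [y] in [L n]; then [a r] lies in [L N2], so [r] is in the colon
   of [L N2], hence in that of [L n]. *)
have : saturation P (adjoin (L n) a) x.
  apply: stab1 => //; apply/(sub_saturation pP)/sub_adjoin.
  by apply: mono Lx; rewrite leq_maxl.
case=> s Ps [y [r [Ly E]]]; apply: (satL n s) => //; rewrite E.
apply: idealD => //; apply: stab2 => //; apply: (mono N2 _ (leq_maxr N1 N2)).
apply: (ideal_addr (iL _) (x := y)); last by rewrite -E; apply: idealMl.
by apply: mono Ly; rewrite geq_max N1n.
Qed.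

(* Krull's principal ideal theorem modulo [Q']. The ideals
   [K n = (Q' + (y^n)) A_Q \cap A] replace symbolic powers: Nakayama forces two
   consecutive ones to agree, which is absurd when [y] is in [Q] but not in [Q']. *)
Lemma principal_ideal_theorem Q' Q P a :
  is_prime_ideal Q' -> is_prime_ideal Q -> is_prime_ideal P ->
  Q' `<` Q -> Q `<` P -> minimal_over (adjoin Q' a) P -> False.
Proof.
move=> pQ' pQ pP [Q'Q nQQ'] [QP nPQ] [_ aP minP].
have /existsNP[y /not_implyP[Qy Q'y]] := nQQ'.
have iQ := prime_ideal pQ; have iQ' := prime_ideal pQ'; have iP := prime_ideal pP.
have nQa : ~ Q a.
  move=> Qa; apply: nPQ.
  by rewrite -(minP Q pQ (adjoin_min iQ Q'Q Qa) QP).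
have Pa : P a by apply/aP/adjoin_mem.
pose K n := saturation Q (adjoin Q' (y ^+ n)).
have iK n : is_ideal (K n) by apply/saturation_ideal/adjoin_ideal.
have KS n : K n.+1 `<=` K n.
  apply: saturationS; apply: adjoin_min; first exact: adjoin_ideal.
    exact: sub_adjoin.
  by rewrite exprS; apply: idealMl; [apply: adjoin_ideal|apply: adjoin_mem].
pose L n := saturation P (adjoin (K n) a).
(* Inside [P], the only prime over [Q' + (a)] is [P] itself, so the descending chain condition
   applies to the [L n]. *)
have [N stab] : exists N, forall n, (N <= n)%N -> L N `<=` L n.
  apply: (saturated_dcc pP (adjoin_ideal a iQ')) => [||n|n|n].
  - by move=> R pR JR RP; apply: minP.
  - by move=> n; apply/saturation_ideal/adjoin_ideal.
  - exact: saturation_saturated.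
  - apply: subset_trans (sub_saturation pP).
    apply: adjoin_min; [exact: adjoin_ideal| |exact: adjoin_mem].
    apply: subset_trans (@sub_adjoin _ _ _).
    exact: subset_trans (@sub_adjoin _ _ _) (sub_saturation pQ).
  - apply: saturationS; apply: adjoin_min; [exact: adjoin_ideal| |exact: adjoin_mem].
    exact: subset_trans (@sub_adjoin _ _ _).
have [s Ks] := noethA (iK N).
pose B := adjoin [set 0 : A] a.
have i0 : is_ideal [set 0 : A] by split=> // c _ _ -> ->; rewrite mulr0 addr0.
have [|x Kx|t Pt KK] := @nakayama A P (K N) (K N.+1) B s pP (iK _) (adjoin_ideal a i0) _ Ks.
- by apply: adjoin_min => // _ ->; apply: ideal0.
(* In [t x = z + a r] the term [a r] lies in [K N], and so does [r] because [a] is outside [Q]. Thus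
   [K N] equals [K N.+1 + a K N] locally at [P]. *)
- have /(stab N.+1 (leqnSn N)) : L N x by apply/(sub_saturation pP)/sub_adjoin.
  case=> t Pt [z [r [Kz E]]]; exists t, z, (a * r); split=> //.
  apply: ideal_mul_mem; first exact: adjoin_mem.
  apply: (saturation_saturated pQ nQa); apply: (ideal_addr (iK N) (KS N _ Kz)).
  by rewrite -E; apply: idealMl.
(* Since [y^N] is now in [K N.+1], some [u] outside [Q] has [u y^N = q + y^(N+1) c] with [q] in
   [Q']. As [y] is outside [Q'], the factor [u - y c] is in [Q'], which puts [u] in [Q]. *)
have : K N (y ^+ N) by apply/(sub_saturation pQ)/adjoin_mem.
move=> /KK/(saturation_saturated pQ (contra_not (QP t) Pt)).
case=> u Qu [q [c [Qq E]]].
have [_ _ Q'M] := pQ'.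
have /Q'M[] : Q' (y ^+ N * (u - y * c)).
  by rewrite mulrBr [_ * u]mulrC E exprSr -!mulrA addrK.
- by move=> /(primeX pQ').
- by move=> /Q'Q Quyc; apply: Qu; rewrite -(subrK (y * c) u); apply: idealD => //; apply: idealMr.
Qed.

(** Locally at [P] the only prime over [I] is [P], so [x] is nilpotent there. Otherwise an ideal
    maximal among those over [I] that avoid all [t x^N], with [t] outside [P], would be a prime
    between [I] and [P] that misses [x]. *)
Lemma minimal_prime_nilpotent I P x : is_ideal I -> minimal_over I P -> P x ->
  exists N t, ~ P t /\ I (t * x ^+ N).
Proof.
move=> iI [pP IP minP] Px; apply: contrapT => H.
pose Fam := [set J | [/\ is_ideal J, I `<=` J & forall N t, ~ P t -> ~ J (t * x ^+ N)]].
have [||J [[iJ IJ nJ] _ maxJ]] := @noetherian_max _ noethA Fam I.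
- by move=> J [].
- by split=> // N t Pt It; apply: H; exists N, t.
have [_ P1 _] := pP.
have pJ : is_prime_ideal J.
  split=> // [J1|y z Jyz]; first by apply: (nJ 0%N 1 P1); rewrite mulr1.
  apply: contrapT => /not_orP[nJy nJz].
  have big u : ~ J u -> exists N t, ~ P t /\ adjoin J u (t * x ^+ N).
    move=> nJu; apply: contrapT => Hu; have [_] := adjoin_proper iJ nJu; apply.
    rewrite -[X in _ `<=` X](maxJ (adjoin J u)) //; last exact: sub_adjoin.
    split; [exact: adjoin_ideal|exact: subset_trans (@sub_adjoin _ _ _)|].
    by move=> N t Pt Ju; apply: Hu; exists N, t.
  have [N [t [Pt [j [r [Jj E]]]]]] := big y nJy.
  have [M [u [Pu [k [v [Jk F]]]]]] := big z nJz.
  apply: (nJ (N + M)%N (t * u)); first exact: primeMN.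
  have -> : t * u * x ^+ (N + M) = (t * x ^+ N) * (u * x ^+ M) by rewrite exprD; ring.
  rewrite E F.
  have -> : (j + y * r) * (k + z * v) = (k + z * v) * j + (y * r * k + r * v * (y * z)) by ring.
  by apply: idealP => //; apply: idealP => //; apply: idealMl.
have JP : J `<=` P.
  by move=> z Jz; apply: contrapT => Pz; apply: (nJ 0%N z Pz); rewrite mulr1.
by apply: (nJ 1%N 1 P1); rewrite mul1r expr1 (minP J).
Qed.

(** Induction on the number of generators. Let [Q] be maximal among the primes strictly below [P]
    that contain the next-to-last prime of the chain, and [b] a generator outside [Q]. Then [P] is
    minimal over [Q + (b)], so every other generator [c] satisfies [t c^N = q + b r] with [q] in [Q]
    and [t] outside [P]. By the principal ideal theorem [Q] is minimal over these [q], which are one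
    fewer. *)
Lemma krull_height (s : seq A) P k p :
  minimal_over (ideal_span [set` s]) P -> prime_chain k p -> p k = P ->
  (k <= size s)%N.
Proof.
move En : (size s) => n; elim: n s P k p En => [|n IH] s P [//|k] p En minP [pp ppS] pk.
  have [_ _ mP] := minP; have [sub] := ppS k (ltnSn k); case.
  rewrite pk (mP (p k)) //; last by rewrite -pk.
    exact: pp.
  by rewrite (size0nil En); apply: ideal_span_min => //; apply/prime_ideal/pp.
have [pP sP mP] := minP; have iP := prime_ideal pP.
have pk_P : p k `<` P by rewrite -pk; apply: ppS.
pose Fam := [set Q | [/\ is_prime_ideal Q, p k `<=` Q & Q `<` P]].
have [||Q [[pQ pkQ [QP nPQ]] _ maxQ]] := @noetherian_max _ noethA Fam (p k).
- by move=> Q [/prime_ideal].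
- by split=> //; apply: pp.
have iQ := prime_ideal pQ.
have [b bs nQb] : exists2 b, b \in s & ~ Q b.
  apply: contrapT => H; apply: nPQ; rewrite -(mP Q) //.
  apply: ideal_span_min => // x xs.
  by apply: contrapT => nQx; apply: H; exists x.
have Pb c : c \in s -> P c by move=> cs; apply: sP; apply: sub_ideal_span.
have minQb : minimal_over (adjoin Q b) P.
  split=> // [|R pR QbR RP]; first by apply: adjoin_min => //; apply: Pb.
  have QR : Q `<=` R := subset_trans (@sub_adjoin _ _ _) QbR.
  rewrite eqEsubset; split=> //; apply: contrapT => nPR; apply: nQb.
  rewrite -(maxQ R) //; last by split=> //; apply: subset_trans QR.
  exact/QbR/adjoin_mem.
have ex c : exists q, c \in s ->
    Q q /\ forall R, is_prime_ideal R -> R `<=` P -> R b -> R q -> R c.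
  have [cs|] := boolP (c \in s); last by exists 0.
  have [N [t [Pt [q [r [Qq E]]]]]] := minimal_prime_nilpotent (adjoin_ideal b iQ) minQb (Pb c cs).
  exists q => _; split=> // R pR RP Rb Rq; have [iR _ RM] := pR.
  have /RM[] : R (t * c ^+ N) by rewrite E; apply: idealD => //; apply: idealMr.
    by move=> /RP.
  exact: primeX.
have [f fP] := choice ex.
have Qmin : minimal_over (ideal_span [set` map f (rem b s)]) Q.
  split=> // [|R pR fR RQ].
    apply: ideal_span_min => // _ /mapP[c /mem_rem cs ->].
    by case: (fP c cs).
  rewrite eqEsubset; split=> //; apply: contrapT => nQR.
  apply: (principal_ideal_theorem pR pQ pP (conj RQ nQR) (conj QP nPQ) (a := b)).
  split=> // [|S pS RbS SP].
    by apply: adjoin_min => //; [apply: subset_trans QP|apply: Pb].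
  have iS := prime_ideal pS; have Sb : S b by apply/RbS/adjoin_mem; case: pR.
  apply: mP => //; apply: ideal_span_min => // c; rewrite /= => cs.
  have [->//|cb] := eqVneq c b.
  have cr : c \in rem b s.
    by move: cs; rewrite (perm_mem (perm_to_rem bs)) inE (negPf cb).
  have Rfc : R (f c).
    by apply: fR; apply: sub_ideal_span; apply/mapP; exists c.
  have [_ fc] := fP c cs; apply: fc => //.
  by apply: RbS; apply: sub_adjoin.
pose p' i := if i == k then Q else p i.
apply: (IH (map f (rem b s)) Q k p') => //.
- by rewrite size_map size_rem // En.
- split=> i ik; rewrite /p'.
    by case: eqP => // _; apply/pp/ltnW.
  rewrite (ltn_eqF ik); have := ppS i (ltnW ik).
  case: eqP => // -> [ii nii]; split; first exact: subset_trans pkQ.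
  by move=> Qi; apply: nii; apply: subset_trans Qi.
- by rewrite /p' eqxx.
Qed.

End Krull.

(** * Hilbert's basis theorem *)

Section HilbertBasis.
Variable A : comNzRingType.
Hypothesis noethA : is_noetherian A.
Implicit Types (J : set {poly A}).

Definition coef_ideal J n : set A := [set c | exists f, [/\ J f, (size f <= n.+1)%N & f`_n = c]].

Lemma coef_ideal_ideal J n : is_ideal J -> is_ideal (coef_ideal J n).
Proof.
move=> iJ; split; first by exists 0; rewrite size_poly0 coef0; split=> //; apply: ideal0.
move=> a _ _ [f [Jf sf <-]] [g [Jg sg <-]]; exists (a%:P * f + g); split.
- exact: idealP.
- rewrite (leq_trans (size_polyD _ _)) // geq_max sg andbT.
  by rewrite mul_polyC (leq_trans (size_scale_leq _ _)).
- by rewrite coefD coefCM.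
Qed.

Lemma coef_idealS J n : is_ideal J -> coef_ideal J n `<=` coef_ideal J n.+1.
Proof.
move=> iJ _ [f [Jf sf <-]]; exists (f * 'X); split; first exact: idealMr.
  have [->|f0] := eqVneq f 0; first by rewrite mul0r size_poly0.
  by rewrite size_mulX.
by rewrite coefMX.
Qed.

(** Subtracting an element of [J'] with the same top coefficient lowers the degree. *)
Lemma coef_ideal_sub J J' : is_ideal J -> is_ideal J' -> J' `<=` J ->
  (forall n, coef_ideal J n `<=` coef_ideal J' n) -> J `<=` J'.
Proof.
move=> iJ iJ' J'J sub f; move Ek : (size f) => k.
have {Ek} : (size f <= k)%N by rewrite Ek.
elim: k f => [|k IH] f sf Jf.
  by move: sf; rewrite leqn0 size_poly_eq0 => /eqP->; apply: ideal0.
have [g [J'g sg Eg]] : coef_ideal J' k f`_k by apply: sub; exists f.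
rewrite -(subrK g f); apply: idealD => //; apply: IH; last by apply: idealB => //; apply: J'J.
apply/leq_sizeP => j; rewrite leq_eqVlt => /predU1P[<-|kj].
  by rewrite coefB Eg subrr.
by rewrite coefB !nth_default ?subrr // (leq_trans _ kj).
Qed.

(** The coefficient ideals ascend with the degree and stop growing at some [N]; lifts of their
    generators in degrees up to [N] generate [J]. *)
Theorem hilbert_basis : is_noetherian {poly A}.
Proof.
move=> J iJ.
have [N stab] := noetherian_acc noethA (fun n => coef_ideal_ideal n iJ)
  (fun n => @coef_idealS J n iJ).
have ex n : exists t : seq {poly A}, [set` t] `<=` J /\
    coef_ideal J n `<=` coef_ideal (ideal_span [set` t]) n.
  have [s Es] := noethA (coef_ideal_ideal n iJ).
  have lift c : exists f : {poly A}, c \in s -> [/\ J f, (size f <= n.+1)%N & f`_n = c].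
    have [cs|] := boolP (c \in s); last by exists 0.
    have [f fP] : coef_ideal J n c by rewrite Es; apply: sub_ideal_span.
    by exists f.
  have [F FP] := choice lift; exists (map F s); split.
    by move=> _ /mapP[c /FP[Jf _ _] ->].
  rewrite [X in X `<=` _]Es; apply: ideal_span_min; first exact/coef_ideal_ideal/ideal_spanP.
  move=> c cs; have [_ sF Fc] := FP _ cs; exists (F c); split=> //.
  by apply: sub_ideal_span; apply/mapP; exists c.
have [t tP] := choice ex.
pose T := flatten [seq t n | n <- iota 0 N.+1].
have TJ : ideal_span [set` T] `<=` J.
  apply: ideal_span_min => // f /flatten_mapP[n _ ft].
  by have [] := tP n => /(_ f ft).
have iT := ideal_spanP [set` T].
exists T; rewrite eqEsubset; split=> //; apply: coef_ideal_sub => //.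
have subN n : (n <= N)%N -> coef_ideal J n `<=` coef_ideal (ideal_span [set` T]) n.
  move=> nN x /(tP n).2[f [Jf sf fx]]; exists f; split=> //.
  apply: ideal_span_min Jf => // g gt; apply: sub_ideal_span; apply/flatten_mapP.
  by exists n => //; rewrite mem_iota.
move=> n; have [/subN//|/ltnW Nn] := leqP n N.
apply: subset_trans (stab n) _; apply: subset_trans (subN N (leqnn N)) _.
exact: (ascending_sub (fun n => @coef_idealS _ n iT)).
Qed.

End HilbertBasis.

(** * Powers of an ideal and the Rees algebra *)

Section IdealPowers.
Variables (R : comNzRingType) (I : set R).
Hypothesis iI : is_ideal I.

Fixpoint ideal_pow (n : nat) : set R :=
  if n is n'.+1 then ideal_mul I (ideal_pow n') else setT.
Local Notation G := ideal_pow.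
Local Arguments ideal_pow : simpl never.

Lemma ideal_pow_ideal n : is_ideal (G n).
Proof. by case: n => [|n] //; apply: ideal_spanP. Qed.

Lemma ideal_pow_mul i j x y : G i x -> G j y -> G (i + j) (x * y).
Proof.
move=> Gx Gy; elim: i x Gx => [|i IH] x Gx.
  by rewrite add0n; apply: idealMl => //; apply: ideal_pow_ideal.
pose J := [set x | G (i.+1 + j) (x * y)].
suff: G i.+1 `<=` J by apply.
apply: ideal_span_min => [|_ [a [b [Ia Gb ->]]]].
  split=> [|a u v Ju Jv]; rewrite /J /=.
    by rewrite mul0r; apply: ideal0; apply: ideal_pow_ideal.
  by rewrite mulrDl -mulrA; exact: (idealP a (ideal_pow_ideal _) Ju Jv).
rewrite /J /= addSn -mulrA; apply: ideal_mul_mem => //; exact: IH.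
Qed.

Lemma ideal_pow1 : G 1 = I.
Proof.
rewrite eqEsubset; split=> [|x Ix].
  by apply: ideal_span_min => // _ [a [b [Ia _ ->]]]; apply: idealMr.
by rewrite -[x]mulr1; apply: ideal_mul_mem.
Qed.

Lemma ideal_pow_sub n : (0 < n)%N -> G n `<=` I.
Proof.
by case: n => // n _; apply: ideal_span_min => // _ [a [b [Ia _ ->]]]; apply: idealMr.
Qed.

Lemma ideal_powD i j : G (i + j) `<=` ideal_mul (G i) (G j).
Proof.
elim: i => [|i IH].
  by rewrite add0n => x Gx; rewrite -[x]mul1r; apply: ideal_mul_mem.
apply: ideal_span_min => [|_ [a [b [Ia /IH Gb ->]]]]; first exact: ideal_spanP.
pose J := [set b | ideal_mul (G i.+1) (G j) (a * b)].
apply: (ideal_span_min (I := J) _ _ Gb) => [|_ [x [y [Gx Gy ->]]]].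
  exact/colon_ideal/ideal_spanP.
by rewrite /J /= mulrA; apply: ideal_mul_mem => //; apply: ideal_mul_mem.
Qed.

Lemma prime_ideal_pow P n : is_prime_ideal P -> G n `<=` P -> I `<=` P.
Proof.
move=> pP GP x Ix; apply: (@primeX _ P x n) => //; apply: GP.
elim: n => // n IH; rewrite exprS; exact: ideal_mul_mem.
Qed.

(** The Rees algebra [R[It]] inside [R[t]], kept as a predicate. *)
Definition rees_poly : set {poly R} := [set f | forall j, G j f`_j].

Lemma rees_polyD f g : rees_poly f -> rees_poly g -> rees_poly (f + g).
Proof. by move=> Bf Bg j; rewrite coefD; apply: idealD => //; apply: ideal_pow_ideal. Qed.

Lemma rees_polyM f g : rees_poly f -> rees_poly g -> rees_poly (f * g).
Proof.
move=> Bf Bg j; rewrite coefM; apply: ideal_sum; first exact: ideal_pow_ideal.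
by move=> [k /= kj] _; rewrite -{1}(subnKC (ltnSE kj)); apply: ideal_pow_mul.
Qed.

Lemma rees_polyC c : rees_poly c%:P.
Proof. by case=> [|j] //; rewrite coefC; apply: ideal0; apply: ideal_pow_ideal. Qed.

Lemma rees_poly_sum (K : Type) (s : seq K) (F : K -> {poly R}) :
  (forall k, rees_poly (F k)) -> rees_poly (\sum_(k <- s) F k).
Proof.
move=> BF; elim/big_rec: _ => [|k f _ Bf]; first by rewrite -polyC0; apply: rees_polyC.
exact: rees_polyD.
Qed.

Lemma rees_polyX x : I x -> rees_poly (x *: 'X).
Proof.
move=> Ix j; rewrite coefZ coefX; have [->|_] := eqVneq j 1%N.
  by rewrite mulr1 ideal_pow1.
by rewrite mulr0; apply: ideal0; apply: ideal_pow_ideal.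
Qed.

(** A ring [S] mapping onto [R[It]] stands in for [R[It]]. Surjectivity is asked on monomials
    [c t^j], the form in which homogeneous ideals are tested. *)
Definition onto_rees (S : comNzRingType) (Phi : S -> {poly R}) : Prop :=
  (forall f, rees_poly (Phi f)) /\
  (forall j c, G j c -> exists f, Phi f = c *: 'X^j).

Lemma onto_reesP (S : comNzRingType) (Phi : {rmorphism S -> {poly R}}) (X : set R) :
  I = ideal_span X -> (forall f, rees_poly (Phi f)) ->
  (forall c, exists f, Phi f = c%:P) -> (forall x, X x -> exists f, Phi f = x *: 'X) ->
  onto_rees Phi.
Proof.
move=> EI PhiG PhiC PhiX; split=> //.
have iD j : is_ideal [set c | exists f, Phi f = c *: 'X^j].
  split; first by exists 0; rewrite rmorph0 scale0r.
  move=> a x y [f fx] [g gy]; have [h ha] := PhiC a.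
  by exists (h * f + g); rewrite rmorphD rmorphM ha fx gy mul_polyC scalerA scalerDl.
have D1 : I `<=` [set c | exists f, Phi f = c *: 'X^1].
  by rewrite EI; apply: ideal_span_min.
elim=> [|j IH] c.
  by have [f fc] := PhiC c; exists f; rewrite fc expr0 alg_polyC.
move: c; apply: (ideal_span_min (iD j.+1)) => _ [x [y [/D1[f fx] /IH[g gy] ->]]].
exists (f * g).
by rewrite rmorphM fx gy -scalerAl -scalerAr scalerA -exprS.
Qed.

Hypothesis noethR : is_noetherian R.

(** Each generator of [I] adds one polynomial variable, sent to that generator times [t]; Hilbert's
    basis theorem keeps [S] Noetherian. *)
Lemma noetherian_onto_rees : exists (S : comNzRingType) (Phi : {rmorphism S -> {poly R}}),
  is_noetherian S /\ onto_rees Phi.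
Proof.
have [s Es] := noethR iI.
have: [set` s] `<=` I by rewrite Es; apply: sub_ideal_span.
suff: [set` s] `<=` I -> exists (S : comNzRingType) (Phi : {rmorphism S -> {poly R}}),
    [/\ is_noetherian S, forall f, rees_poly (Phi f), forall c, exists f, Phi f = c%:P &
        forall x, x \in s -> exists f, Phi f = x *: 'X].
  move=> H /H[S [Phi [nS PhiG PhiC PhiX]]]; exists S, Phi; split=> //.
  exact: onto_reesP PhiX.
elim: s {Es} => [|x s IH] sI.
  by exists R, polyC; split=> // [f|c]; [apply: rees_polyC|exists c].
have [S [Phi [nS PhiG PhiC PhiX]]] : exists (S : comNzRingType) (Phi : {rmorphism S -> {poly R}}),
    [/\ is_noetherian S, forall f, rees_poly (Phi f), forall c, exists f, Phi f = c%:P &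
        forall x, x \in s -> exists f, Phi f = x *: 'X].
  by apply: IH => y ys; apply: sI; rewrite /= inE ys orbT.
have cX : commr_rmorph Phi (x *: 'X) by move=> y; apply: mulrC.
exists {poly S}, (horner_morph cX); split.
- exact: hilbert_basis.
- move=> f; rewrite /= /horner_morph horner_coef; apply: rees_poly_sum => i.
  rewrite coef_map; apply: rees_polyM; first exact: PhiG.
  case: i => i /= _; elim: i => [|k IHk].
    by rewrite expr0 -polyC1; apply: rees_polyC.
  rewrite exprS; apply: rees_polyM => //; apply: rees_polyX.
  by apply: sI; rewrite /= mem_head.
- by move=> c; have [f fc] := PhiC c; exists f%:P; rewrite /= horner_morphC.
- move=> y; rewrite inE => /predU1P[->|/PhiX[f fy]]; first by exists 'X; rewrite /= horner_morphX.
  by exists f%:P; rewrite /= horner_morphC.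
Qed.

End IdealPowers.

(** * Homogeneous ideals and parameters of the fiber cone *)

Section FiberCone.
Variables (R : comNzRingType) (m I : set R).
Hypotheses (noethR : is_noetherian R) (maxm : is_maximal_ideal m) (iI : is_ideal I).
Local Notation G := (ideal_pow I).
Local Arguments ideal_pow : simpl never.
Let iG := ideal_pow_ideal I.
Implicit Types (B C P Q : nat -> set R).

Lemma maximal_prime : is_prime_ideal m.
Proof.
have [im m1 mm] := maxm; split=> // x y mxy.
have [mx|nmx] := pselect (m x); first by left.
right; have [z [r [mz E]]] : adjoin m x 1.
  apply: contrapT => n1; apply: nmx.
  by rewrite -(mm _ (adjoin_ideal x im) n1 (@sub_adjoin _ _ _)); apply: adjoin_mem.
have -> : y = y * z + r * (x * y) by rewrite mulrA [r * x]mulrC [y * z]mulrC -mulrDl -E mul1r.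
by apply: idealP => //; apply: idealMl.
Qed.

(* Homogeneous ideals of the fiber cone [F = \bigoplus_j I^j / m I^j], given by
   their components in [I^j]. *)
Record graded_ideal B : Prop := GradedIdeal {
  graded_component : forall j, is_ideal (B j);
  graded_sub : forall j, B j `<=` G j;
  graded_mul : forall i j x y, G i x -> B j y -> B (i + j)%N (x * y);
  graded_max : forall j, ideal_mul m (G j) `<=` B j }.

Definition graded_le B C : Prop := forall j, B j `<=` C j.

Definition graded_lt B C : Prop := graded_le B C /\ ~ graded_le C B.

Record graded_prime P : Prop := GradedPrime {
  graded_prime_ideal : graded_ideal P;
  graded_prime_proper : ~ P 0%N 1;
  graded_primeM : forall i j x y, G i x -> G j y -> P (i + j)%N (x * y) -> P i x \/ P j y }.

Lemma graded_le_trans C B D : graded_le B C -> graded_le C D -> graded_le B D.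
Proof. by move=> BC CD j; apply: subset_trans (CD j). Qed.

Section Preimage.
Variables (S : comNzRingType) (Phi : {rmorphism S -> {poly R}}).
Hypothesis PhiG : onto_rees I Phi.

Definition graded_preimage B : set S := [set f | forall j, B j (Phi f)`_j].

Lemma graded_preimage_ideal B : graded_ideal B -> is_ideal (graded_preimage B).
Proof.
case=> iB _ BM _; split=> [j|a x y Bx By j].
  by rewrite rmorph0 coef0; apply: ideal0.
rewrite rmorphD rmorphM coefD; apply: idealD => //; rewrite coefM.
apply: ideal_sum => // [[k /= kj]] _; rewrite -[j in B j](subnKC (ltnSE kj)).
by apply: BM => //; apply: PhiG.1.
Qed.

Lemma graded_preimageS B C : graded_ideal B -> graded_ideal C ->
  graded_preimage B `<=` graded_preimage C -> graded_le B C.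
Proof.
move=> gB gC BC j x Bx; have [f fx] := PhiG.2 j x (graded_sub gB Bx).
have : graded_preimage C f.
  apply: BC => k; rewrite fx coefZ coefXn; have [->|_] := eqVneq k j.
    by rewrite mulr1.
  by rewrite mulr0; apply: ideal0; apply: graded_component.
by move=> /(_ j); rewrite fx coefZ coefXn eqxx mulr1.
Qed.

Lemma graded_preimage_lt B C : graded_ideal B -> graded_ideal C ->
  graded_lt B C -> graded_preimage B `<` graded_preimage C.
Proof.
move=> gB gC [BC nCB]; split=> [f Bf j|CB]; first by apply: BC; apply: Bf.
by apply: nCB; apply: graded_preimageS.
Qed.

(** With [i] and [j] the lowest degrees in which the images of [f] and [g] leave [P], the
    coefficient of the product in degree [i + j] is, modulo [P], the product of these two
    components. *)
Lemma graded_preimage_prime P : graded_prime P -> is_prime_ideal (graded_preimage P).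
Proof.
case=> gP P1 PM; have iP := graded_preimage_ideal gP.
have first_out f : ~ graded_preimage P f ->
    exists j, ~ P j (Phi f)`_j /\ forall k, (k < j)%N -> P k (Phi f)`_k.
  rewrite /graded_preimage => /existsNP[j nPj]; have ex : exists j, `[< ~ P j (Phi f)`_j >].
    by exists j; apply/asboolP.
  case: (ex_minnP ex) => i /asboolP nPi mini; exists i; split=> // k ki.
  apply: contrapT => nPk; have /mini : `[< ~ P k (Phi f)`_k >] by apply/asboolP.
  by rewrite leqNgt ki.
split=> // [/(_ 0%N)|f g Pfg]; first by rewrite rmorph1 coef1.
apply: contrapT => /not_orP[/first_out[i [nPi mini]] /first_out[j [nPj minj]]].
have := Pfg (i + j)%N; rewrite rmorphM coefM.
have ii : (i < (i + j).+1)%N by rewrite ltnS leq_addr.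
rewrite (bigD1 (Ordinal ii)) //= addKn addrC => H.
have [] // := PM i j _ _ (PhiG.1 f i) (PhiG.1 g j).
apply: ideal_addr H; first exact: graded_component.
apply: ideal_sum => [|[k /= kij]]; first exact: graded_component.
rewrite -val_eqE /= neq_ltn => /orP[ki|ik].
  rewrite mulrC -{1}(subnK (ltnSE kij)).
  by apply: graded_mul => //; [apply: PhiG.1|apply: mini].
rewrite -{1}(subnKC (ltnSE kij)).
apply: graded_mul => //; [exact: PhiG.1|apply: minj].
by rewrite ltn_subLR ?(ltnSE kij) // ltn_add2r.
Qed.

End Preimage.

(** Noetherian induction is inherited from [S] through [graded_preimage], which preserves strict
    inclusions. *)
Lemma graded_ind (Pr : (nat -> set R) -> Prop) :
  (forall B, graded_ideal B -> (forall C, graded_ideal C -> graded_lt B C -> Pr C) -> Pr B) ->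
  forall B, graded_ideal B -> Pr B.
Proof.
move=> PrS; have [S [Phi [nS PhiG]]] := noetherian_onto_rees iI noethR.
suff H : forall J, is_ideal J ->
    forall B, graded_ideal B -> graded_preimage Phi B = J -> Pr B.
  by move=> B gB; exact: (H _ (graded_preimage_ideal PhiG gB) B gB).
apply: (noetherian_ind nS) => J iJ IH B gB EJ; apply: PrS => // C gC BC.
apply: (IH (graded_preimage Phi C)) => //; first exact: graded_preimage_ideal.
by rewrite -EJ; apply: graded_preimage_lt.
Qed.

(** The multipliers that carry degree [d] into degree [j]. For [j < d] truncated subtraction would
    give all of R, hence the explicit zero. *)
Definition shifted_pow d j : set R := [set r | if (d <= j)%N then G (j - d) r else r = 0].

Lemma shifted_pow_ideal d j : is_ideal (shifted_pow d j).
Proof.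
rewrite /shifted_pow; case: leqP => _; first exact: iG.
by split=> // a x y /= -> ->; rewrite mulr0 addr0.
Qed.

Lemma shifted_pow_mul i d j x y :
  G i x -> shifted_pow d j y -> shifted_pow d (i + j) (x * y).
Proof.
rewrite /shifted_pow /= => Gx; case: leqP => [dj|_ ->].
  by rewrite (leq_trans dj (leq_addl _ _)) -addnBA // => Gy; apply: ideal_pow_mul.
by rewrite mulr0; exact: (ideal0 (shifted_pow_ideal d (i + j))).
Qed.

Lemma shifted_powE d j a r : G d a -> shifted_pow d j r -> G j (a * r).
Proof.
rewrite /shifted_pow /= => Ga; case: leqP => [dj Gr|_ ->].
  by rewrite -(subnKC dj); apply: ideal_pow_mul.
by rewrite mulr0; apply: ideal0.
Qed.

Definition graded_adjoin B d a : nat -> set R :=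
  fun j => [set x | exists y r, [/\ B j y, shifted_pow d j r & x = y + a * r]].

Lemma graded_adjoin_ideal B d a :
  graded_ideal B -> G d a -> graded_ideal (graded_adjoin B d a).
Proof.
move=> gB Ga; have [iB BG BM Bm] := gB; split=> [j|j|i j x _ Gx [y [r [By Hr ->]]]|j x mx].
- split; first by exists 0, 0; rewrite mulr0 addr0; split;
    [exact: (ideal0 (iB j))|exact: (ideal0 (shifted_pow_ideal d j))|].
  move=> c _ _ [y [r [By Hr ->]]] [z [s [Bz Hs ->]]]; exists (c * y + z), (c * r + s); split.
  + exact: idealP.
  + by apply: idealP => //; apply: shifted_pow_ideal.
  + by ring.
- move=> _ [y [r [By Hr ->]]]; apply: idealD => //; first exact: BG.
  exact: shifted_powE Hr.
- exists (x * y), (x * r); split; [exact: BM|exact: shifted_pow_mul|by ring].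
- exists x, 0; rewrite mulr0 addr0; split=> //; first exact: Bm.
  exact: (ideal0 (shifted_pow_ideal d j)).
Qed.

Lemma graded_le_adjoin B d a : graded_le B (graded_adjoin B d a).
Proof.
move=> j x Bx; exists x, 0; rewrite mulr0 addr0; split=> //.
exact: (ideal0 (shifted_pow_ideal d j)).
Qed.

Lemma graded_adjoin_min B C d a : graded_ideal C -> graded_le B C -> C d a ->
  graded_le (graded_adjoin B d a) C.
Proof.
move=> [iC _ CM _] BC Ca j _ [y [r [By + ->]]]; rewrite /shifted_pow /=.
case: leqP => [dj Gr|_ ->]; last by rewrite mulr0 addr0; apply: BC.
apply: idealD => //; first exact: BC.
by rewrite mulrC -(subnK dj); apply: CM.
Qed.

Lemma graded_adjoin_lt B d a : graded_ideal B -> G d a -> ~ B d a ->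
  graded_lt B (graded_adjoin B d a).
Proof.
move=> gB Ga nBa; split; first exact: graded_le_adjoin.
move=> /(_ d a)H; apply/nBa/H; exists 0, 1; rewrite mulr1 add0r; split=> //.
  by apply: ideal0; apply: graded_component.
by rewrite /shifted_pow /= leqnn subnn.
Qed.

Lemma graded_prime_ind (Pr : (nat -> set R) -> Prop) :
  (forall B, graded_ideal B -> B 0%N 1 -> Pr B) ->
  (forall B, graded_prime B -> Pr B) ->
  (forall B d a e b, graded_ideal B -> G d a -> G e b -> B (d + e)%N (a * b) ->
    Pr (graded_adjoin B d a) -> Pr (graded_adjoin B e b) -> Pr B) ->
  forall B, graded_ideal B -> Pr B.
Proof.
move=> Pr1 Prp PrM; apply: graded_ind => B gB IH.
have [B1|nB1] := pselect (B 0%N 1); first exact: Pr1.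
have [pB|npB] := pselect (graded_prime B); first exact: Prp.
have [[d [a [e [b [Ga Gb Bab nBa nBb]]]]]|H] := pselect (exists d a e b,
  [/\ G d a, G e b, B (d + e)%N (a * b), ~ B d a & ~ B e b]).
  apply: (PrM B d a e b) => //; apply: IH; by [apply: graded_adjoin_ideal|apply: graded_adjoin_lt].
case: npB; split=> // i j x y Gx Gy Bxy; apply: contrapT => /not_orP[nBx nBy].
by apply: H; exists i, x, j, y.
Qed.

Lemma graded_primes_over B : graded_ideal B ->
  exists2 Qs : seq (nat -> set R),
    (forall Q, List.In Q Qs -> graded_prime Q /\ graded_le B Q) &
    forall P, graded_prime P -> graded_le B P -> exists2 Q, List.In Q Qs & graded_le Q P.
Proof.
move: B; apply: graded_prime_ind =>
  [B gB B1|B pB|B d a e b gB Ga Gb Bab [Qs QsP Qsmin] [Rs RsP Rsmin]].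
- by exists [::] => // P [_ P1 _] /(_ 0%N 1 B1).
- exists [:: B] => [Q [<-|[]]|P pP BP]; first by split=> // j.
  by exists B => //; left.
exists (Qs ++ Rs) => [Q /List.in_app_iff[/QsP|/RsP] [pQ BQ]|P pP BP].
- by split=> //; apply: graded_le_trans BQ; apply: graded_le_adjoin.
- by split=> //; apply: graded_le_trans BQ; apply: graded_le_adjoin.
have gP := graded_prime_ideal pP.
have [Pa|Pb] := graded_primeM pP Ga Gb (BP _ _ Bab).
  have [Q QQs QP] := Qsmin P pP (graded_adjoin_min gP BP Pa).
  by exists Q => //; apply/List.in_app_iff; left.
have [Q QRs QP] := Rsmin P pP (graded_adjoin_min gP BP Pb).
by exists Q => //; apply/List.in_app_iff; right.
Qed.

(** If [I^N] lies in [B + (a)] and [I^M] in [B + (b)] with [a b] in [B], the products that span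
    [I^(N+M)] lie in [B]. The base cases are [N = 0] for the unit ideal and [N = 1] for a prime. *)
Lemma irrelevant_power B : graded_ideal B ->
  (forall P, graded_prime P -> graded_le B P -> G 1 `<=` P 1%N) ->
  exists N, G N `<=` B N.
Proof.
move: B; apply: graded_prime_ind => [B gB B1 _|B pB irr|B d a e b gB Ga Gb Bab IHa IHb irr].
- by exists 0%N => x _; apply: ideal_eq1 B1; apply: graded_component.
- by exists 1%N; apply: (irr B pB) => j.
have [N GN] : exists N, G N `<=` graded_adjoin B d a N.
  apply: IHa => P pP BP; apply: irr => //.
  by apply: graded_le_trans BP; apply: graded_le_adjoin.
have [M GM] : exists N, G N `<=` graded_adjoin B e b N.
  apply: IHb => P pP BP; apply: irr => //.
  by apply: graded_le_trans BP; apply: graded_le_adjoin.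
have [iB BG BM _] := gB.
exists (N + M)%N => x /ideal_powD; move: x.
apply: ideal_span_min => // _ [x [y [Gx Gy ->]]].
have [x' [r [Bx' Hr Ex]]] := GN _ Gx; have [y' [s [By' Hs Ey]]] := GM _ Gy.
have -> : x * y = y * x' + ((a * r) * y' + (a * b) * (r * s)) by rewrite Ex Ey; ring.
apply: idealD => //; first by rewrite addnC; apply: BM.
apply: idealD => //; first by apply: BM => //; apply: shifted_powE Hr.
move: Hr Hs; rewrite /shifted_pow /=; case: leqP => [dN Gr|_ ->]; last first.
  by rewrite mul0r mulr0 => _; apply: ideal0.
case: leqP => [eM Gs|_ ->]; last by rewrite !mulr0; apply: ideal0.
have -> : (N + M = (N - d + (M - e)) + (d + e))%N.
  by rewrite addnACA !subnK.
by rewrite mulrC; apply: BM => //; apply: ideal_pow_mul.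
Qed.

Definition relevant P : Prop := ~ G 1 `<=` P 1%N.

Lemma graded_primeX P d x n : graded_prime P -> G d x -> P (n * d)%N (x ^+ n) -> P d x.
Proof.
move=> pP Gx; have [gP P1 PM] := pP; elim: n => [|n IH].
  by rewrite mul0n expr0.
rewrite mulSn exprS => /PM[] //.
elim: n {IH} => [|n IH] //; rewrite mulSn exprS; exact: ideal_pow_mul.
Qed.

Lemma ideal_powX d x n : G d x -> G (n * d) (x ^+ n).
Proof.
move=> Gx; elim: n => [|n IH] //; rewrite mulSn exprS; exact: ideal_pow_mul.
Qed.

Lemma graded_powX P d x n : graded_ideal P -> G d x -> P d x -> (0 < n)%N -> P (n * d)%N (x ^+ n).
Proof.
move=> gP Gx Px; case: n => // n _; rewrite mulSnr exprSr.
by apply: graded_mul => //; apply: ideal_powX.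
Qed.

(* If [f] avoids [Qs] but not [P], and [g] avoids [P] but lies in all of [Qs],
   then [f ^ (deg g) + g ^ (deg f)] avoids everything. *)
Lemma graded_prime_avoidance (Qs : seq (nat -> set R)) :
  (forall Q, List.In Q Qs -> graded_prime Q /\ relevant Q) ->
  exists d f, [/\ (0 < d)%N, G d f & forall Q, List.In Q Qs -> ~ Q d f].
Proof.
move En : (size Qs) => n; elim: n Qs En => [|n IH] [|P Qs] //= En QsP.
  by exists 1%N, 0; split=> //; apply: ideal0.
have {}En : size Qs = n by case: En.
have [pP relP] := QsP P (or_introl (erefl _)).
have [d [f [d0 Gf Qsf]]] := IH Qs En (fun Q QQs => QsP Q (or_intror QQs)).
have [Pf|nPf] := pselect (P d f); last first.
  by exists d, f; split=> // Q [<-|/Qsf].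
suff: (exists e g, [/\ (0 < e)%N, G e g & forall Q, List.In Q (P :: Qs) -> ~ Q e g]) \/
      exists e g, [/\ (0 < e)%N, G e g, ~ P e g & forall Q, List.In Q Qs -> Q e g].
  case=> [[e [g [e0 Gg Hg]]]|[e [g [e0 Gg nPg Qsg]]]]; first by exists e, g.
  exists (e * d)%N, (f ^+ e + g ^+ d); split; first by rewrite muln_gt0 e0.
    by apply: idealD => //; [|rewrite mulnC]; apply: ideal_powX.
  move=> Q [<-|QQs] Qfg.
    have gP := graded_prime_ideal pP.
    apply: nPg; apply: (graded_primeX (n := d) pP Gg); rewrite mulnC.
    by apply: ideal_addr Qfg; [apply: graded_component|apply: graded_powX].
  have [pQ _] := QsP Q (or_intror QQs); have gQ := graded_prime_ideal pQ.
  apply: (Qsf Q QQs); apply: (graded_primeX (n := e) pQ Gf); rewrite addrC in Qfg.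
  apply: ideal_addr Qfg; first exact: graded_component.
  by rewrite mulnC; apply: graded_powX => //; apply: Qsg.
have /existsNP[x /not_implyP[Gx nPx]] := relP.
(* [g] is built as a product over the list. For each [Q], the induction hypothesis without [Q] gives
   [h] avoiding all the other primes; either [h] avoids [Q] too and settles the claim, or it lies in
   [Q] and joins the product. Starting from [x] of degree 1 keeps the degree positive. *)
suff: forall Q1 Q2 : seq (nat -> set R), Qs = Q1 ++ Q2 ->
    (exists e g, [/\ (0 < e)%N, G e g & forall Q, List.In Q (P :: Qs) -> ~ Q e g]) \/
    exists e g, [/\ (0 < e)%N, G e g, ~ P e g & forall Q, List.In Q Q2 -> Q e g].
  by move=> /(_ [::] Qs (erefl _)).
move=> Q1 Q2; elim: Q2 Q1 => [|Q Q2 IHQ] Q1 EQ.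
  by right; exists 1%N, x.
have [|H|[e [g [e0 Gg nPg Q2g]]]] := IHQ (rcons Q1 Q); [by rewrite cat_rcons|by left|].
have inQs Q' : List.In Q' (P :: Q1 ++ Q2) -> List.In Q' (P :: Qs).
  case=> [->|/List.in_app_iff[H|H]]; [by left|right|right]; rewrite EQ; apply/List.in_app_iff.
    by left.
  by right; right.
have [||c [h [c0 Gh Hh]]] := IH (P :: Q1 ++ Q2).
- by move: En; rewrite EQ /= !size_cat /= addnS.
- by move=> Q' /inQs/QsP.
have [Qh|nQh] := pselect (Q c h); last first.
  left; exists c, h; split=> // Q' [<-|]; first by apply: Hh; left.
  rewrite EQ => /List.in_app_iff[Q'1|[<-//|Q'2]]; apply: Hh; right; apply/List.in_app_iff.
    by left.
  by right.
right; exists (e + c)%N, (g * h); split.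
- by rewrite addn_gt0 e0.
- exact: ideal_pow_mul.
- by move=> /(graded_primeM pP Gg Gh)[//|]; apply: Hh; left.
move=> Q' [<-|Q'2].
  have [pQ _] : graded_prime Q /\ relevant Q.
    by apply: QsP; right; rewrite EQ; apply/List.in_app_iff; right; left.
  by apply: graded_mul => //; apply: graded_prime_ideal.
have [pQ' _] : graded_prime Q' /\ relevant Q'.
  by apply: QsP; right; rewrite EQ; apply/List.in_app_iff; right; right.
rewrite addnC mulrC; apply: graded_mul => //; first exact: graded_prime_ideal.
exact: Q2g.
Qed.

Definition graded_chain k (p : nat -> nat -> set R) : Prop :=
  (forall i, (i <= k)%N -> graded_prime (p i)) /\
  (forall i, (i < k)%N -> graded_lt (p i) (p i.+1)).

Lemma graded_chain_rcons k p P : graded_chain k p -> graded_prime P ->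
  graded_lt (p k) P -> exists2 q, graded_chain k.+1 q & q k.+1 = P.
Proof.
move=> [pp ppS] pP pkP; exists (fun i => if (i <= k)%N then p i else P); last by rewrite ltnn.
split=> i ik; first by case: leqP => // /pp.
move: ik; rewrite ltnS => ik; rewrite ik; case: ltnP => [|ki]; first exact: ppS.
by have -> : i = k by apply/eqP; rewrite eqn_leq ik.
Qed.

Implicit Types fs : seq (nat * R).

Definition homogeneous_in fs B : Prop := forall f, f \in fs -> B f.1 f.2.

(** The condition [G j x] keeps this a graded ideal when some generator lies outside its [G], where
    the intersection alone would be everything. *)
Definition graded_span fs : nat -> set R :=
  fun j => [set x | G j x /\ forall B, graded_ideal B -> homogeneous_in fs B -> B j x].

Lemma graded_span_ideal fs : graded_ideal (graded_span fs).
Proof.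
split=> [j|j x []//|i j x y Gx [Gy Hy]|j x mx].
- split; first by split=> [|B gB _]; apply: ideal0 => //; apply: graded_component.
  move=> a x y [Gx Hx] [Gy Hy]; split=> [|B gB fB]; first exact: idealP.
  by apply: idealP; [apply: graded_component|apply: Hx|apply: Hy].
- split=> [|B gB fB]; first exact: ideal_pow_mul.
  by apply: graded_mul => //; apply: Hy.
- split=> [|B gB _]; last exact: graded_max.
  move: x mx; apply: ideal_span_min => // _ [a [x [_ Gx ->]]]; exact: idealMl.
Qed.

Lemma graded_span_min fs B : graded_ideal B -> homogeneous_in fs B ->
  graded_le (graded_span fs) B.
Proof. by move=> gB fB j x [_]; apply. Qed.

(** Each new element avoids every relevant prime in a finite list that lies below all primes over
    the previous ones. A relevant prime over the enlarged system therefore strictly contains a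
    member of that list, and the chain below it grows by one. *)
Lemma fiber_parameters k : exists fs, [/\ size fs = k,
    forall f, f \in fs -> (0 < f.1)%N /\ G f.1 f.2 &
    forall P, graded_prime P -> relevant P -> homogeneous_in fs P ->
      exists2 p, graded_chain k p & p k = P].
Proof.
elim: k => [|k [fs [sfs fsG fsP]]].
  by exists [::]; split=> // P pP _ _; exists (fun=> P).
have [Qs QsP Qsmin] := graded_primes_over (graded_span_ideal fs).
have [Rs RsP] : exists Rs, forall Q, List.In Q Rs <-> List.In Q Qs /\ relevant Q.
  exists (List.filter (fun Q => `[< relevant Q >]) Qs) => Q; rewrite List.filter_In.
  by split=> [[? /asboolP]|[? /asboolP]].
have [|d [f [d0 Gf nRf]]] := @graded_prime_avoidance Rs.
  by move=> Q /RsP[/QsP[]].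
exists ((d, f) :: fs); split; first by rewrite /= sfs.
  by move=> g; rewrite inE => /predU1P[->|/fsG].
move=> P pP relP fP; have gP := graded_prime_ideal pP.
have [|Q QQs QP] := Qsmin P pP.
  by apply: graded_span_min => // g gfs; apply: fP; rewrite inE gfs orbT.
have [pQ fsQ] := QsP Q QQs.
have relQ : relevant Q by apply: contra_not relP => H; apply: subset_trans (QP _).
have [p cp pQE] : exists2 p, graded_chain k p & p k = Q.
  apply: fsP => // g gfs; apply: fsQ; split; first by case: (fsG g gfs).
  by move=> B _; apply.
apply: (graded_chain_rcons cp) => //; rewrite pQE; split=> // PQ.
apply: (nRf Q); first exact/RsP.
by apply: PQ; apply: (fP (d, f)); rewrite mem_head.
Qed.

Definition irrelevant : nat -> set R := fun j => if j is 0%N then m else G j.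

Lemma irrelevant_prime : graded_prime irrelevant.
Proof.
have pm := maximal_prime; have [im m1 mM] := pm.
have sub j : irrelevant j `<=` G j by case: j => [|j] x Hx.
have gI : graded_ideal irrelevant.
  split=> [[|j]||[|i] [|j] x y Gx Iy|j]; [exact: im|exact: iG|exact: sub|..].
  - exact: idealMl.
  - exact: (ideal_pow_mul Gx Iy).
  - exact: (ideal_pow_mul Gx (j := 0)).
  - exact: (ideal_pow_mul Gx Iy).
  case: j => [|j]; apply: ideal_span_min.
  - exact: im.
  - by move=> _ [a [x [ma _ ->]]]; apply: idealMr.
  - exact: iG.
  - by move=> _ [a [x [_ Gx ->]]]; apply: (idealMl a (iG j.+1) Gx).
split=> // [[|i] [|j] x y Gx Gy Hxy]; [exact: mM|by right|by left|by left].
Qed.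

Lemma graded_prime_le_irrelevant P : graded_prime P -> graded_le P irrelevant.
Proof.
case=> gP P1 _ [|j]; last exact: (graded_sub gP).
have [im m1 mm] := maxm; rewrite /= (mm (P 0%N)) //; first exact: (graded_component gP).
move=> x mx; apply: (graded_max gP); rewrite -[x]mulr1; exact: ideal_mul_mem.
Qed.

(** A relevant prime over [k] parameters would end a chain of length [k], which the irrelevant ideal
    would prolong. So no prime over the parameters is relevant, and [irrelevant_power] applies. *)
Lemma fiber_reduction k : (forall p, ~ graded_chain k.+1 p) ->
  exists fs : seq R, [/\ size fs = k, forall f, f \in fs -> I f &
    exists N, forall x, G N x -> exists y z,
      [/\ ideal_span [set` fs] y, ideal_mul m (G N) z & x = y + z]].
Proof.
move=> nochain; have [fs [sfs fsG fsP]] := fiber_parameters k.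
exists (map snd fs); split; first by rewrite size_map.
  move=> _ /mapP[f /fsG[f0 Gf] ->]; exact: ideal_pow_sub Gf.
have [|N GN] := irrelevant_power (graded_span_ideal fs).
  move=> P pP fsP'; apply: contrapT => relP.
  have [p cp pP'] : exists2 p, graded_chain k p & p k = P.
    apply: fsP => // f ffs; apply: fsP'; split; first by case: (fsG f ffs).
    by move=> B _; apply.
  have [|q cq _] := graded_chain_rcons cp irrelevant_prime.
    rewrite pP'; split; first exact: graded_prime_le_irrelevant.
    by move=> /(_ 1%N); apply: relP.
  exact: nochain cq.
(* The span is tested against the homogeneous ideal with components [G j] intersected with
   [(fs) + m G j]. *)
exists N => x /GN[Gx /(_ (fun j => [set x | G j x /\ exists y z,
  [/\ ideal_span [set` map snd fs] y, ideal_mul m (G j) z & x = y + z]]))[]] //.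
  have iS := ideal_spanP [set` map snd fs].
  split=> [j|j y []//|i j y z Gy [Gz [u [v [Su mv Ez]]]]|j y my].
  - have imG : is_ideal (ideal_mul m (G j)) by apply: ideal_spanP.
    split; first by split; [exact: (ideal0 (iG j))|
      exists 0, 0; rewrite addr0; split=> //; apply: ideal0].
    move=> a y z [Gy [u [v [Su mv Ey]]]] [Gz [u' [v' [Su' mv' Ez]]]].
    split; first exact: (idealP a (iG j)).
    exists (a * u + u'), (a * v + v').
    by split; [exact: (idealP a iS)|exact: (idealP a imG)|rewrite Ey Ez; ring].
  - split; first exact: ideal_pow_mul.
    exists (y * u), (y * v); split; [exact: (idealMl y iS)| |by rewrite Ez mulrDr].
    have imG : is_ideal (ideal_mul m (G (i + j))) by apply: ideal_spanP.
    move: v mv {Ez}; apply: (@ideal_span_min _ _ (colon (ideal_mul m (G (i + j))) y)).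
      exact: colon_ideal.
    move=> _ [a [w [ma Gw ->]]]; rewrite /colon /= mulrCA; apply: ideal_mul_mem => //.
    exact: ideal_pow_mul.
  - split; last by exists 0, y; rewrite add0r; split=> //; apply: ideal0.
    move: y my; apply: ideal_span_min; first exact: iG.
    by move=> _ [a [y [_ Gy ->]]]; apply: (idealMl a (iG j) Gy).
move=> f ffs; have [f0 Gf] := fsG f ffs; split=> //; exists f.2, 0; rewrite addr0; split=> //.
  by apply: sub_ideal_span; apply/mapP; exists f.
by apply: ideal0; apply: ideal_spanP.
Qed.

End FiberCone.

(** * Base change to the total ring of fractions, and the rank *)

Section TensorZero.
Variables (R : comNzRingType) (M N : lmodType R).

Lemma tens0l (y : N) : tens (0 : M) y = 0.
Proof.
by have := tens_linearl (-1) (0 : M) 0 y; rewrite scaler0 addr0 scaleN1r addNr.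
Qed.

Lemma tens0r (x : M) : tens x (0 : N) = 0.
Proof.
by have := tens_linearr (-1) x (0 : N) 0; rewrite scaler0 addr0 scaleN1r addNr.
Qed.

Variables (W : lmodType R) (f : M -> N -> W).
Hypothesis fl : forall a u v y, f (a *: u + v) y = a *: f u y + f v y.
Hypothesis fr : forall a x u v, f x (a *: u + v) = a *: f x u + f x v.

Lemma tensor_lift_0 : tensor_lift f 0 = 0.
Proof.
by have := tensor_lift_linear fl fr (-1) 0 0; rewrite scaler0 addr0 scaleN1r addNr.
Qed.

End TensorZero.

Section TotalFractionAlgebra.
Variable R : comNzRingType.
Local Notation Q := (total_frac R).

Lemma tfrac_alg (x : R) : x%:A = tfrac x (nzd1 R) :> Q.
Proof. exact: mulr1. Qed.

Lemma tfrac_alg_inj (x : R) : x%:A = 0 :> Q -> x = 0.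
Proof. by rewrite tfrac_alg => /tfracE; rewrite mulr1 mul0r. Qed.

Lemma nzd_scale_eq0 (s : R) (q : Q) : GRing.lreg s -> s *: q = 0 -> q = 0.
Proof.
have [x [t [ht ->]]] := tfracP q => sreg.
rewrite -mulr_algl tfrac_alg [_ * _]tf_mulE => sx; move/tfracE: (sx : _ = tfrac 0 (nzd1 R)).
rewrite mulr1 mul0r => sx0.
by apply/tfracE; rewrite mulr1 mul0r; apply: sreg; rewrite sx0 mulr0.
Qed.

Lemma clear_denominator (q : Q) : exists sx : R * R, GRing.lreg sx.1 /\ sx.1 *: q = sx.2%:A.
Proof.
have [x [s [hs ->]]] := tfracP q; exists (s, x); split; first exact/asboolP.
by rewrite /= -[s *: _]mulr_algl !tfrac_alg [_ * _]tf_mulE; apply/tfracE => /=; ring.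
Qed.

Lemma clear_denominators n (u : 'rV[Q]_n) : exists s (w : 'rV[R]_n),
  GRing.lreg s /\ forall i, s *: u 0 i = (w 0 i)%:A.
Proof.
have [f fP] := choice (fun i => clear_denominator (u 0 i)).
exists (\prod_i (f i).1), (\row_i ((\prod_(j | j != i) (f j).1) * (f i).2)); split.
  elim/big_rec: _ => [|i x _ xreg]; first exact: lreg1.
  by apply: lregM => //; case: (fP i).
move=> i; rewrite mxE (bigD1 i) //= [(f i).1 * _]mulrC -!scalerA.
by case: (fP i) => _ ->.
Qed.

(** A common denominator turns a relation over [Q] into one over R. *)
Lemma map_alg_injective r n (psi : 'M[R]_(r, n)) :
  (forall u : 'rV_r, u *m psi = 0 -> u = 0) ->
  forall u : 'rV[Q]_r, u *m map_mx (GRing.in_alg Q) psi = 0 -> u = 0.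
Proof.
move=> inj u u0; have [s [w [sreg wP]]] := clear_denominators u.
have w0 : w = 0.
  apply: inj; apply/rowP => j; rewrite !mxE; apply: tfrac_alg_inj.
  have := congr1 (fun M : 'rV[Q]_n => s *: M 0 j) u0.
  rewrite !mxE scaler0 => <-; rewrite scaler_suml scaler_sumr; apply: eq_bigr => i _.
  by rewrite mxE /= mulr_algr scalerA [s * _]mulrC -[RHS]scalerA wP scalerA mulrC.
apply/rowP => i; rewrite mxE; apply: (nzd_scale_eq0 sreg).
by rewrite wP w0 mxE scale0r.
Qed.

End TotalFractionAlgebra.

Section Presentation.
Variables (R : comNzRingType) (E : lmodType R) (r n : nat).
Variables (psi : 'M[R]_(r, n)) (p : {linear 'rV[R]_n -> E}).
Hypotheses (presp : is_presentation psi p) (injpsi : forall u : 'rV_r, u *m psi = 0 -> u = 0).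

Lemma presentation_lift : exists lift : E -> 'rV[R]_n, forall x, p (lift x) = x.
Proof. by have [surjp _] := presp; have [lift] := choice surjp; exists lift. Qed.

Lemma presentation_row i : p (row i psi) = 0.
Proof. by have [_ kerp] := presp; apply/kerp; exists (delta_mx 0 i); rewrite -rowE. Qed.

Lemma presentation_eq v w : p v = p w -> exists u, v = w + u *m psi.
Proof.
have [_ kerp] := presp; move=> pvw; have /kerp[u Eu] : p (v - w) = 0 by rewrite linearB pvw subrr.
by exists u; rewrite -Eu addrC subrK.
Qed.

Local Notation Q := (total_frac R).
Local Notation psiQ := (map_mx (GRing.in_alg Q) psi).

Lemma base_change_scale (a b : Q) (x : E) :
  a *: (tens x b : base_change E Q) = tens x (a * b).
Proof.
apply: (tensor_liftE (f := fun x b => tens x (a * b))) => [c u v y|c y u v].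
  exact: tens_linearl.
by rewrite mulrDr -scalerAr tens_linearr.
Qed.

Lemma tens_suml (I : Type) (s : seq I) (c : I -> R) (x : I -> E) (y : Q) :
  tens (\sum_(i <- s) c i *: x i) y = \sum_(i <- s) tens (x i) (c i *: y).
Proof.
elim: s => [|i s IH]; first by rewrite !big_nil tens0l.
rewrite !big_cons tens_linearl IH; congr (_ + _).
by have := tens_linearr (c i) (x i) y 0; rewrite !addr0 tens0r addr0 => ->.
Qed.

(** Exactness in the middle after base change: [(x, q)] goes to the class of [q] times a lift of [x]
    modulo the rows of [psi], which is bilinear since two lifts differ by such rows. Functions
    ['I_n -> Q] serve here because they form an R-module, while row vectors over [Q] form a
    [Q]-module. *)
Lemma tensor_presentation_eq0 (v : 'rV[Q]_n) :
  \sum_i tens (p (delta_mx 0 i)) (v 0 i) = 0 :> tensor E Q ->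
  exists u, v = u *m psiQ.
Proof.
pose Nset : {ffun 'I_n -> Q} -> Prop := fun y =>
  exists u : 'rV[Q]_r, forall j, y j = (u *m psiQ) 0 j.
have NP : submodule_closed (V := {ffun 'I_n -> Q}) Nset.
  split; first by exists 0 => j; rewrite mul0mx ffunE mxE.
  move=> a x y [u xu] [w yw]; exists (a%:A *: u + w) => j.
  by rewrite !ffunE mulmxDl -scalemxAl !mxE xu yw !mxE mulr_algl.
pose N := Submodule NP.
have [lift liftP] := presentation_lift.
pose h (x : E) (q : Q) : lquot N := lpi N [ffun j => lift x 0 j *: q].
have hl a x y q : h (a *: x + y) q = a *: h x q + h y q.
  rewrite /h -linearP; apply/lpiE.
  have [|w Ew] := @presentation_eq (lift (a *: x + y)) (a *: lift x + lift y).
    by rewrite linearP !liftP.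
  exists (q *: map_mx (GRing.in_alg Q) w) => j.
  rewrite !ffunE Ew !mxE scalerA -scalerDl -scalerBl.
  rewrite addrAC subrr add0r scaler_suml; apply: eq_bigr => i _.
  by rewrite !mxE /= !mulr_algr scalerA mulrC.
have hr a x q q' : h x (a *: q + q') = a *: h x q + h x q'.
  rewrite /h -linearP; congr lpi; apply/ffunP => j.
  by rewrite !ffunE scalerDr !scalerA mulrC.
move=> v0; pose L := tensor_lift (fun x q => h x q).
have : L (\sum_i tens (p (delta_mx 0 i)) (v 0 i)) = 0.
  by rewrite v0; apply: tensor_lift_0 hl hr.
have -> : L (\sum_i tens (p (delta_mx 0 i)) (v 0 i)) =
    \sum_i h (p (delta_mx 0 i)) (v 0 i).
  elim: (index_enum _) => [|i s IH].
    by rewrite !big_nil; apply: tensor_lift_0 hl hr.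
  rewrite !big_cons -IH; have := tensor_lift_linear hl hr 1 (tens (p (delta_mx 0 i)) (v 0 i)).
  move=> /(_ (\sum_(j <- s) tens (p (delta_mx 0 j)) (v 0 j))).
  by rewrite !scale1r (tensor_liftE hl hr).
have [w wP] : exists w : 'I_n -> 'rV_r,
    forall i, lift (p (delta_mx 0 i)) = delta_mx 0 i + w i *m psi.
  have ex i : exists u, lift (p (delta_mx 0 i)) = delta_mx 0 i + u *m psi.
    by apply: presentation_eq; rewrite liftP.
  by have [w wP] := choice ex; exists w.
rewrite /h -linear_sum => lpi0.
have [u Hu] : N (\sum_i [ffun j => lift (p (delta_mx 0 i)) 0 j *: v 0 i]).
  by rewrite -[X in N X]subr0; apply/lpiE; rewrite lpi0 linear0.
exists (u - \row_k (\sum_i (w i 0 k) *: v 0 i)).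
apply/rowP => j; rewrite mulmxBl mxE -Hu sum_ffunE mxE.
apply/eqP; rewrite eq_sym subr_eq; apply/eqP.
under eq_bigr => i _ do rewrite ffunE wP !mxE eqxx /= scalerDl.
rewrite big_split /=; congr (_ + _).
  rewrite (bigD1 j) //= eqxx scale1r big1 ?addr0 // => i ij.
  by rewrite eq_sym (negPf ij) scale0r.
under eq_bigr do rewrite scaler_suml.
rewrite exchange_big [RHS]mxE /=; apply: eq_bigr => k _; rewrite !mxE mulr_suml.
by apply: eq_bigr => i _; rewrite mulr_algr scalerA mulrC.
Qed.

(** Over [Q], the rows of [psi] and lifts of a basis of [Q^e] stack to an invertible matrix [D] with
    [r + e] rows and [n] columns, which must be square. *)
Lemma rank_presentation e : has_rank E e -> n = (r + e)%N.
Proof.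
case=> f [g fK gK].
pose b (i : 'I_n) : base_change E Q := tens (p (delta_mx 0 i)) 1.
pose B : 'M[Q]_(n, e) := \matrix_i f (b i).
have fB (v : 'rV[Q]_n) : f (\sum_i tens (p (delta_mx 0 i)) (v 0 i) : tensor E Q) = v *m B.
  rewrite mulmx_sum_row linear_sum; apply: eq_bigr => i _.
  by rewrite rowK -linearZ base_change_scale mulr1.
have gen (t : tensor E Q) : exists v : 'rV[Q]_n, t = \sum_i tens (p (delta_mx 0 i)) (v 0 i).
  elim/tensor_ind: t => [|a x y t [v ->]].
    exists 0; have /= := congr1 g (fB 0).
    by rewrite fK mul0mx -(linear0 f) fK => ->.
  have [surjp _] := presp; have [w <-] := surjp x; exists (\row_i (a *: (w 0 i *: y)) + v).
  rewrite {1}[w]row_sum_delta linear_sum; under eq_bigr do rewrite linearZ.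
  rewrite tens_suml scaler_sumr -big_split; apply: eq_bigr => i _ /=.
  by rewrite mxE -tens_linearr mxE.
have surj (z : 'rV_e) : exists v, v *m B = z.
  by have [v Ev] := gen (g z); exists v; rewrite -fB -Ev gK.
have exB (v : 'rV[Q]_n) : v *m B = 0 -> exists u, v = u *m psiQ.
  rewrite -fB -(linear0 f) => /(congr1 g); rewrite !fK; exact: tensor_presentation_eq0.
have psiB : psiQ *m B = 0.
  apply/row_matrixP => i; rewrite row_mul row0 -fB -(linear0 f); congr (f _).
  transitivity (tens (p (row i psi)) 1 : tensor E Q).
    rewrite [row i psi in RHS]row_sum_delta linear_sum.
    under [X in tens X]eq_bigr do rewrite linearZ.
    by rewrite tens_suml; apply: eq_bigr => j _; rewrite !mxE.
  by rewrite presentation_row tens0l.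
have [c cP] := choice surj.
pose C : 'M[Q]_(e, n) := \matrix_i c (delta_mx 0 i).
have CB : C *m B = 1%:M.
  by apply/row_matrixP => i; rewrite row_mul rowK cP row1.
pose D := col_mx psiQ C.
have [H HD] : exists H : 'M_(n, r + e), H *m D = 1%:M.
  have ex (i : 'I_n) : exists u : 'rV_(r + e), u *m D = delta_mx 0 i.
    have [|u Eu] := exB (delta_mx 0 i - (delta_mx 0 i *m B) *m C).
      by rewrite mulmxBl -[_ *m C *m B]mulmxA CB mulmx1 subrr.
    exists (row_mx u (delta_mx 0 i *m B)); rewrite mul_row_col -Eu.
    by rewrite subrK.
  have [F FP] := choice ex; exists (\matrix_i F i).
  by apply/row_matrixP => i; rewrite row_mul rowK FP row1.
have injD (u : 'rV_(r + e)) : u *m D = 0 -> u = 0.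
  rewrite -[u]hsubmxK mul_row_col => u0.
  have u2 : rsubmx u = 0.
    have := congr1 (mulmx^~ B) u0.
    by rewrite mulmxDl -!mulmxA psiB CB mulmx0 add0r mulmx1 mul0mx.
  move: u0; rewrite u2 mul0mx addr0 => /(map_alg_injective injpsi)->.
  by rewrite row_mx0.
have DH : D *m H = 1%:M.
  apply/eqP; rewrite -subr_eq0; apply/eqP/row_matrixP => i; rewrite row0.
  by apply: injD; rewrite -row_mul mulmxBl -mulmxA HD mulmx1 mul1mx subrr row0.
by apply/eqP; rewrite eqn_leq (mulmx1_min HD) (mulmx1_min DH).
Qed.

End Presentation.

(** * Freeness of the first syzygy over a local ring *)

Section LocalRing.
Variables (R : comNzRingType) (m : set R).
Hypotheses (noethR : is_noetherian R).
Hypothesis (localR : forall I, is_maximal_ideal I <-> I = m).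

Lemma local_unit x : ~ m x -> exists y, y * x = 1.
Proof.
move=> nmx; apply: contrapT => H.
have i0 : is_ideal [set 0 : R] by split=> // c _ _ -> ->; rewrite mulr0 addr0.
pose Fam := [set J : set R | is_ideal J /\ ~ J 1].
have [||J [[iJ J1] xJ maxJ]] := @noetherian_max _ noethR Fam (adjoin [set 0] x).
- by move=> J [].
- split; first exact: adjoin_ideal.
  by move=> [_ [y [-> E]]]; apply: H; exists y; rewrite E add0r mulrC.
have /localR EJ : is_maximal_ideal J by split=> // K iK K1 JK; apply: maxJ.
by apply: nmx; rewrite -EJ; apply: xJ; apply: adjoin_mem.
Qed.

Variables (E : lmodType R) (n : nat) (p : {linear 'rV[R]_n -> E}).

Lemma mulmx_row' r (w : 'rV[R]_r.+1) (psi : 'M[R]_(r.+1, n)) i :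
  w 0 i = 0 -> w *m psi = col' i w *m row' i psi.
Proof.
move=> wi; apply/rowP => j; rewrite !mxE (bigD1_ord i) //= wi mul0r add0r.
by apply: eq_bigr => k _; rewrite !mxE.
Qed.

(** [r] is the least number of rows presenting [E] through [p]: a relation with a unit coefficient
    would let one row be dropped. *)
Lemma minimal_presentation k (phi : 'M[R]_(k, n)) : is_presentation phi p ->
  exists r (psi : 'M[R]_(r, n)), is_presentation psi p /\
    forall u : 'rV_r, u *m psi = 0 -> forall i, m (u 0 i).
Proof.
move=> presphi.
pose ok r := `[< exists psi : 'M[R]_(r, n), is_presentation psi p >].
have ex : exists r, ok r by exists k; apply/asboolP; exists phi.
case: (ex_minnP ex) => r /asboolP[psi [surjp kerp]] minr; exists r, psi; split=> // u u0 i.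
apply: contrapT => /local_unit[y yui].
case: r psi kerp minr u u0 i yui => [|r] psi kerp minr u u0 i yui; first by case: i {yui}.
have /minr : ok r; last by rewrite ltnn.
apply/asboolP; exists (row' i psi); split=> // v; split=> [/kerp[w ->]|[w ->]].
  exists (col' i (w - (w 0 i * y) *: u)).
  rewrite -mulmx_row'; last by rewrite !mxE -mulrA yui mulr1 subrr.
  by rewrite mulmxBl -scalemxAl u0 scaler0 subr0.
apply/kerp; exists (\row_j if unlift i j is Some k then w 0 k else 0).
rewrite (mulmx_row' _ (i := i)) ?mxE ?unlift_none //; congr (_ *m _).
by apply/rowP => j; rewrite !mxE liftK.
Qed.

(* With [b] lifting [p] through [pi] and [al] lifting [pi] through [p], the
   identity of [ker p] is [al b - (al b - 1)]; the first summand factors through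
   [K] and the second through a free module, so both lift along [psi]. *)
Lemma kernel_section r (psi : 'M[R]_(r, n)) (K P : lmodType R)
    (i : {linear K -> P}) (pi : {linear P -> E}) :
  is_presentation psi p -> is_projective P -> is_projective K -> injective i ->
  (forall y, exists x, pi x = y) -> (forall x, pi x = 0 <-> exists k, i k = x) ->
  exists S : 'M[R]_r, S *m psi = psi /\
    forall u : 'rV_r, u *m psi = 0 -> u *m S = 0.
Proof.
move=> pres projP projK inji surjpi kerpi; have [surjp kerp] := pres.
have [al alP] := projP _ _ p pi surjp.
have [b bP] := choice (fun j : 'I_n => surjpi (p (delta_mx 0 j))).
pose be (v : 'rV[R]_n) := \sum_j v 0 j *: b j.
have pibe v : pi (be v) = p v.
  rewrite linear_sum [v in RHS]row_sum_delta linear_sum.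
  by apply: eq_bigr => j _; rewrite !linearZ /= bP.
(* [lquot N] is a copy of the row space of [psi], the kernel of [p]; through it the projectivity of
   [K] yields the lift [h] of [al] after [i]. *)
pose Nset : 'rV[R]_r -> Prop := fun u => u *m psi = 0.
have NP : submodule_closed (V := 'rV[R]_r) Nset.
  split; first by rewrite /Nset mul0mx.
  by move=> a x y Nx Ny; rewrite /Nset mulmxDl -scalemxAl Nx Ny scaler0 addr0.
pose N := Submodule NP.
have exg (k : K) : exists u : 'rV_r, u *m psi = al (i k).
  have /kerp[u Eu] : p (al (i k)) = 0 by rewrite alP; apply/kerpi; exists k.
  by exists u.
have [g gP] := choice exg.
have gL : linear (fun k => lpi N (g k)).
  move=> a x y; rewrite -linearP; apply/lpiE.
  by rewrite /= /Nset mulmxBl mulmxDl -scalemxAl !gP (linearP i) (linearP al) subrr.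
pose gl := GRing.isLinear.Build R K (lquot N) *:%R _ gL.
pose G : {linear K -> lquot N} := HB.pack (fun k => lpi N (g k)) gl.
have [h hP] := projK _ _ (lpi N) G (@lpi_surj _ _ N).
have hal k : h k *m psi = al (i k).
  by have /lpiE := hP k; rewrite /= /Nset mulmxBl gP => /eqP; rewrite subr_eq0 => /eqP.
have exD (j : 'I_n) : exists d : 'rV_r, d *m psi = al (b j) - delta_mx 0 j.
  have /kerp[d Ed] : p (al (b j) - delta_mx 0 j) = 0 by rewrite linearB alP bP subrr.
  by exists d.
have [d dP] := choice exD; pose D := \matrix_j d j.
have DP v : v *m D *m psi = al (be v) - v.
  rewrite -mulmxA mulmx_sum_row [X in _ = _ - X]row_sum_delta linear_sum -sumrB.
  apply: eq_bigr => j _.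
  by rewrite row_mul rowK dP scalerBr [in RHS]linearZ.
have exk (l : 'I_r) : exists k, i k = be (row l psi).
  by apply/kerpi; rewrite pibe; apply/kerp; exists (delta_mx 0 l); rewrite -rowE.
have [k kP] := choice exk.
exists (\matrix_l (h (k l) - row l psi *m D)); split=> [|u u0].
  apply/row_matrixP => l; rewrite row_mul rowK mulmxBl DP hal kP.
  by rewrite opprB addrCA subrr addr0.
have -> : \matrix_l (h (k l) - row l psi *m D) = \matrix_l h (k l) - psi *m D.
  by apply/row_matrixP => l; rewrite linearB /= !rowK row_mul.
rewrite mulmxBr mulmxA u0 mul0mx subr0 mulmx_sum_row.
under eq_bigr do rewrite rowK -linearZ.
rewrite -linear_sum; have -> : \sum_l u 0 l *: k l = 0; last exact: linear0.
apply: inji; rewrite linear0 linear_sum.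
under eq_bigr do rewrite linearZ /= kP scaler_sumr.
rewrite exchange_big big1 //= => j _.
under eq_bigr do rewrite mxE scalerA.
rewrite -scaler_suml; have := congr1 (fun M : 'rV[R]_n => M 0 j) u0.
by rewrite !mxE => ->; rewrite scale0r.
Qed.

(** The rows of [S - 1] are relations, whose entries lie in [m] by minimality. So [S] is the
    identity modulo [m], hence invertible, and [u S = 0] gives [u = 0]. *)
Lemma free_presentation k (phi : 'M[R]_(k, n)) : proj_res 1 E -> is_presentation phi p ->
  exists r (psi : 'M[R]_(r, n)), is_presentation psi p /\
    forall u : 'rV_r, u *m psi = 0 -> u = 0.
Proof.
move=> res1 /minimal_presentation[r [psi [pres minpsi]]]; exists r, psi; split=> //.
have maxm : is_maximal_ideal m by apply/localR.
have pm := maximal_prime maxm; have im := prime_ideal pm.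
have [S [Spsi S0]] : exists S : 'M[R]_r, S *m psi = psi /\
    forall u : 'rV_r, u *m psi = 0 -> u *m S = 0.
  inversion res1 as [|n0 K P M i pi projP inji surjpi kerpi resK]; subst.
  inversion resK; subst.
  exact: (kernel_section pres projP _ inji surjpi kerpi).
have mdet : m (\det S - \det (1%:M : 'M[R]_r)).
  apply: det_congr_ideal => // l j.
  have -> : S l j - (1%:M : 'M[R]_r) l j = (row l (S - 1%:M)) 0 j by rewrite !mxE.
  by apply: minpsi; rewrite -row_mul mulmxBl Spsi mul1mx subrr row0.
have [y Ey] : exists y, y * \det S = 1.
  apply: local_unit => mS; have [_ m1 _] := maxm; apply: m1.
  rewrite -(det1 R r) -[X in m X]opprK; apply: idealN => //.
  exact: (ideal_addr im mS).
move=> u u0; have /(congr1 (fun M => y *: (M *m \adj S))) := S0 u u0.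
by rewrite mul0mx scaler0 -mulmxA mul_mx_adj mul_mx_scalar scalerA Ey scale1r.
Qed.

End LocalRing.

(** * The determinantal linear form on the exterior power *)

Section MinorForm.
Variables (R : comNzRingType) (E : lmodType R) (r e : nat).
Variables (psi : 'M[R]_(r, r + e)) (p : {linear 'rV[R]_(r + e) -> E}).
Hypothesis pres : is_presentation psi p.

(** Two lifts differ by combinations of the rows of [psi], which is a unipotent row operation. *)
Lemma det_col_mx_congr (Y Y' : 'M[R]_(e, r + e)) :
  (forall j, p (row j Y) = p (row j Y')) -> \det (col_mx psi Y) = \det (col_mx psi Y').
Proof.
move=> pY; have [w wP] := choice (fun j => presentation_eq pres (pY j)).
have -> : Y = Y' + (\matrix_j w j) *m psi.
  by apply/row_matrixP => j; rewrite linearD /= row_mul rowK wP.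
have -> : col_mx psi (Y' + (\matrix_j w j) *m psi) =
    block_mx 1%:M 0 (\matrix_j w j) 1%:M *m col_mx psi Y'.
  by rewrite mul_block_col !mul1mx mul0mx addr0 addrC.
by rewrite det_mulmx det_lblock !det1 !mul1r.
Qed.

Definition lifts (x : 'I_e -> E) : 'M[R]_(e, r + e) :=
  \matrix_j sval (cid (proj1 pres (x j))).

Lemma liftsP x j : p (row j (lifts x)) = x j.
Proof. by rewrite rowK; case: cid. Qed.

Definition minor_form (x : 'I_e -> E) : R := \det (col_mx psi (lifts x)).

Lemma minor_formE x (Y : 'M[R]_(e, r + e)) :
  (forall j, p (row j Y) = x j) -> minor_form x = \det (col_mx psi Y).
Proof. by move=> pY; apply: det_col_mx_congr => j; rewrite liftsP pY. Qed.

Local Notation minor_map0 := (malg_lift (fun x : {ffun 'I_e -> E} => minor_form x : R^o)).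

Lemma minor_map0_ext w : Defs.span (@ext_rel R E e) w -> minor_map0 w = 0.
Proof.
move=> Sw; apply: (Sw [set w | minor_map0 w = 0]) => [|z].
  split=> [|a x y /= x0 y0]; first exact: raddf0.
  by rewrite linearP /= x0 y0 scaler0 addr0.
case=> [[x [i [a [u [v ->]]]]]|[x [i [j [ij xij ->]]]]].
  rewrite /= linearB linearP /= !malg_liftU; apply/eqP; rewrite subr_eq0; apply/eqP.
  (* The chosen lifts need not be linear, so the [i]-th one is replaced by a lift [t] that can be
     taken as a linear combination. *)
  pose L (t : 'rV[R]_(r + e)) : 'M[R]_(e, r + e) := \matrix_j if j == i then t else row j (lifts x).
  have LE t s : p t = s -> minor_form (subst x i s) = \det (col_mx psi (L t)).
    move=> pt; apply: minor_formE => j; rewrite rowK ffunE.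
    by case: eqP => // _; apply: liftsP.
  have rowL t t' : row' (rshift r i) (col_mx psi (L t)) = row' (rshift r i) (col_mx psi (L t')).
    apply/matrixP => c d; rewrite !mxE; case: splitP => // k Ek; rewrite !mxE.
    case: eqP => // ki; case/eqP: (neq_lift (rshift r i) c); apply: val_inj.
    by rewrite [RHS]Ek ki.
  have [surjp _] := pres; have [s su] := surjp u; have [t tv] := surjp v.
  rewrite (LE (a *: s + t)) ?linearP ?su ?tv // (LE s) // (LE t) //.
  rewrite -[X in _ = _ + X]mul1r; apply: (determinant_multilinear (i0 := rshift r i)).
  - by rewrite !rowKd !rowK eqxx scale1r.
  - exact: rowL.
  - exact: rowL.
rewrite /= malg_liftU.
rewrite (@minor_formE x (\matrix_k row (if k == j then i else k) (lifts x))); last first.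
  by move=> k; rewrite rowK liftsP; case: eqP => // ->.
apply: (determinant_alternate (i1 := rshift r i) (i2 := rshift r j)).
  by rewrite (inj_eq (@rshift_inj _ _)).
move=> l; rewrite !col_mxEd !mxE eqxx; by case: eqP.
Qed.

Definition minor_map : ext_power E e -> R := lquot_lift minor_map0.

Lemma minor_mapE w : minor_map (lpi _ w) = minor_map0 w.
Proof. exact: (lquot_liftE minor_map0_ext). Qed.

Lemma minor_mapP a x y : minor_map (a *: x + y) = a * minor_map x + minor_map y.
Proof. exact: (lquot_lift_linear minor_map0_ext). Qed.

Lemma minor_map_ideal : is_ideal (range minor_map).
Proof.
split=> [|a _ _ [x _ <-] [y _ <-]]; last by exists (a *: x + y) => //; apply: minor_mapP.
by exists (lpi _ 0) => //; rewrite minor_mapE linear0.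
Qed.

Lemma minor_map_det (Y : 'M[R]_(e, r + e)) : range minor_map (\det (col_mx psi Y)).
Proof.
exists (lpi _ << [ffun j => p (row j Y)] >>) => //; rewrite minor_mapE malg_liftU.
by apply: minor_formE => j; rewrite ffunE.
Qed.

Lemma minor_map_sub J : is_ideal J -> (forall x, J (minor_form x)) -> range minor_map `<=` J.
Proof.
move=> iJ Jx _ [w _ <-]; have [g <-] := lpi_surj w; rewrite minor_mapE.
by apply: ideal_sum => // x _; apply: idealMl.
Qed.

(** [psi] is completed by unit rows [Y] at the columns outside the image of [g]. Multiplying by the
    column selection [(H1 H2)] gives a block triangular matrix with determinant the minor, so the
    minor is a multiple of a value of the form. *)
Lemma minor_map_colsub (g : 'I_r -> 'I_(r + e)) : range minor_map (\det (colsub g psi)).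
Proof.
have [injg|/injectivePn[i [j ij gij]]] := boolP (injectiveb g); last first.
  rewrite -det_tr (determinant_alternate ij); first exact: (ideal0 minor_map_ideal).
  by move=> k; rewrite !mxE gij.
have {}injg : injective g by apply/injectiveP.
pose C := ~: [set g i | i : 'I_r].
have cardC : #|C| = e.
  by apply/eqP; rewrite -(eqn_add2l #|[set g i | i : 'I_r]|) cardsC card_imset // !card_ord.
pose c (j : 'I_e) : 'I_(r + e) := enum_val (cast_ord (esym cardC) j).
have injc : injective c by move=> j k /enum_val_inj/cast_ord_inj.
have gc i j : (c j == g i) = false.
  apply/eqP => cg; have := enum_valP (cast_ord (esym cardC) j).
  by rewrite -/(c j) cg inE imset_f.
pose Y : 'M[R]_(e, r + e) := \matrix_(j, k) (k == c j)%:R.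
pose H1 : 'M[R]_(r + e, r) := \matrix_(k, i) (k == g i)%:R.
pose H2 : 'M[R]_(r + e, e) := \matrix_(k, j) (k == c j)%:R.
have E1 : psi *m H1 = colsub g psi.
  apply/matrixP => i j; rewrite !mxE (bigD1 (g j)) //= !mxE eqxx mulr1.
  by rewrite big1 ?addr0 // => k /negPf kg; rewrite !mxE kg mulr0.
have E2 : Y *m H1 = 0.
  apply/matrixP => i j; rewrite !mxE big1 // => k _; rewrite !mxE.
  by case: eqP => [->|_]; rewrite ?gc ?mulr0 ?mul0r.
have E3 : Y *m H2 = 1%:M.
  apply/matrixP => i j; rewrite !mxE (bigD1 (c i)) //= !mxE eqxx mul1r (inj_eq injc).
  by rewrite big1 ?addr0 // => k /negPf kc; rewrite !mxE kc mul0r.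
have := congr1 determinant (mul_col_row psi Y H1 H2).
rewrite E1 E2 E3 det_ublock det1 mulr1 det_mulmx => <-.
by apply: (idealMr _ minor_map_ideal); apply: minor_map_det.
Qed.

(** The rows of [phi] are combinations of those of [psi], so each minor of [phi] is a multiple of
    the minor of [psi] in the same columns. *)
Lemma minors_sub_minor_map k (phi : 'M[R]_(k, r + e)) :
  is_presentation phi p -> ideal_span (minors r phi) `<=` range minor_map.
Proof.
move=> presphi; apply: ideal_span_min; first exact: minor_map_ideal.
move=> _ [f [g ->]].
have ex i : exists u, row i phi = u *m psi.
  have [_ kerp] := pres; apply/kerp; exact: (presentation_row presphi).
have [c cP] := choice ex.
have -> : mxsub f g phi = (\matrix_i c (f i)) *m colsub g psi.
  apply/matrixP => i j; have := congr1 (fun M : 'rV[R]_(r + e) => M 0 (g j)) (cP (f i)).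
  by rewrite !mxE => ->; apply: eq_bigr => l _; rewrite !mxE.
by rewrite det_mulmx; apply: (idealMl _ minor_map_ideal); apply: minor_map_colsub.
Qed.

(** With a unit determinant, the rows of [psi] and the lifts form a basis of [R^(r+e)], so the [x_j]
    form a basis of [E]; [c] reads off coordinates. *)
Lemma minor_form_unit_projective x y : y * minor_form x = 1 -> is_projective E.
Proof.
move=> yx U W g f surjg.
set X := lifts x; pose V := col_mx psi X; pose V' := y *: \adj V.
have VV' : V *m V' = 1%:M by rewrite -scalemxAr mul_mx_adj scale_scalar_mx yx.
have V'V : V' *m V = 1%:M by rewrite -scalemxAl mul_adj_mx scale_scalar_mx yx.
have [lift liftP] := presentation_lift pres.
have [u uP] := choice (fun j => surjg (f (x j))).
pose c t : 'rV[R]_e := rsubmx (lift t *m V').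
have psiV' : rsubmx (psi *m V') = 0.
  have := congr1 (fun M => rsubmx (usubmx M)) VV'.
  rewrite mul_col_mx col_mxKu => ->.
  by rewrite (scalar_mx_block r e 1) /block_mx col_mxKu row_mxKr.
have cP a s t : c (a *: s + t) = a *: c s + c t.
  have [|w Ew] := @presentation_eq _ _ _ _ _ _ pres (lift (a *: s + t)) (a *: lift s + lift t).
    by rewrite linearP !liftP.
  rewrite /c Ew !mulmxDl -scalemxAl -[w *m psi *m V']mulmxA !linearD /= linearZ /=.
  by rewrite -[rsubmx (w *m _)]mulmx_rsub psiV' mulmx0 addr0.
have hL : linear (fun t => \sum_j c t 0 j *: u j).
  move=> a s t; rewrite scaler_sumr -big_split; apply: eq_bigr => j _ /=.
  by rewrite cP !mxE scalerDl scalerA.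
pose hl := GRing.isLinear.Build R E U *:%R _ hL.
pose h : {linear E -> U} := HB.pack (fun t => \sum_j c t 0 j *: u j) hl.
exists h => t; rewrite /= linear_sum.
under eq_bigr do rewrite linearZ uP.
transitivity (f (\sum_j c t 0 j *: x j)).
  by rewrite linear_sum; apply: eq_bigr => j _; rewrite linearZ.
congr (f _); rewrite -[t in RHS]liftP -[lift t]mulmx1 -V'V mulmxA.
rewrite -[lift t *m V']hsubmxK mul_row_col linearD /=.
have -> : p (lsubmx (lift t *m V') *m psi) = 0.
  by have [_ kerp] := pres; apply/kerp; exists (lsubmx (lift t *m V')).
rewrite add0r mulmx_sum_row linear_sum; apply: eq_bigr => j _.
by rewrite linearZ /= liftsP.
Qed.

End MinorForm.

(** * Suprema and infima of extended integers *)

Section ExtendedIntegers.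
Local Open Scope order_scope.
Implicit Types (A : set (\bar int)) (N : set nat).
Local Notation nat_bar n := ((n%:Z)%:E : \bar int).

Lemma supremum_le A (y : \bar int) : (forall x, A x -> x <= y) -> supremum -oo%E A <= y.
Proof.
move=> Ay; rewrite /supremum; case: eqP => _; first exact: leNye.
by case: xgetP => [x _ [_]|_]; [apply|rewrite leNye].
Qed.

(** [supremum] falls back on its default when there is no least upper bound; here it is the maximum
    of [N], or [+oo] when [N] is unbounded. *)
Lemma nat_supremums_exist N : N !=set0 -> supremums [set nat_bar n | n in N] !=set0.
Proof.
case=> n0 Nn0; have [[b bN]|unb] := pselect (exists b, forall n, N n -> (n <= b)%N).
  have ex : exists n, `[< N n >] by exists n0; apply/asboolP.
  have ub n : `[< N n >] -> (n <= b)%N by move=> /asboolP/bN.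
  case: (ex_maxnP ex ub) => i /asboolP Ni maxi; exists (nat_bar i); split.
    by move=> _ [n Nn <-]; rewrite lee_fin lez_nat; apply/maxi/asboolP.
  by move=> y; apply; exists i.
exists +oo%E; split=> [y _|y yub]; first exact: leey.
have {yub} yub n : N n -> nat_bar n <= y by move=> Nn; apply: yub; exists n.
case: y yub => [r|//|] yub; last by have := yub n0 Nn0.
case: unb; exists `|r|%N => n /yub; rewrite lee_fin => nr.
by rewrite -lez_nat gez0_abs // (le_trans _ nr).
Qed.

Lemma supremum_ge N n : N n -> nat_bar n <= supremum -oo%E [set nat_bar n | n in N].
Proof.
move=> Nn; apply: ge_supremum_Nmem; last by exists n.
by apply: nat_supremums_exist; exists n.
Qed.

Lemma infimum_mem A : A !=set0 -> (forall x, A x -> 0%E <= x) ->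
  A (infimum +oo%E A) /\ lbound A (infimum +oo%E A).
Proof.
move=> A0 Age0.
have [z Az zlb] : exists2 z, A z & lbound A z.
  have [[n0 An0]|nofin] := pselect (exists n, A (nat_bar n)).
    have ex : exists n, `[< A (nat_bar n) >] by exists n0; apply/asboolP.
    case: (ex_minnP ex) => n /asboolP An minn; exists (nat_bar n) => // y Ay.
    case: y Ay (Age0 y Ay) => [[k|k]||] Ay //= _.
    by rewrite lee_fin lez_nat; apply: minn; apply/asboolP.
  have [y Ay] := A0; exists +oo%E; last first.
    by case=> [[k|k]||] //= Ak; [case: nofin; exists k|have := Age0 _ Ak|have := Age0 _ Ak].
  by case: y Ay (Age0 y Ay) => [[k|k]||] //= Ay _; case: nofin; exists k.
have infz : infimums A z by split=> // y; apply.
suff -> : infimum +oo%E A = z by [].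
rewrite /infimum; case: eqP => [A_0|_]; first by rewrite A_0 in Az.
by apply: xget_subset1 => //; apply: is_subset1_infimums.
Qed.

(** A projective [E] would have a resolution of length 0, and the infimum would be at most 0. *)
Lemma proj_dim1 (R : comNzRingType) (E : lmodType R) : proj_dim E = 1%:Z%:E ->
  proj_res 1 E /\ ~ is_projective E.
Proof.
rewrite /proj_dim; set S := [set _ | _ in _] => infS.
have [E0|/set0P S0] := eqVneq S set0; first by move: infS; rewrite E0 /infimum eqxx.
have [|Sinf lbinf] := infimum_mem S0; first by move=> _ [n _ <-].
rewrite infS in Sinf lbinf; split=> [|projE].
  by have [n resn [<-]] := Sinf.
have /lbinf : S (nat_bar 0) by exists 0%N => //; apply: ProjRes0.
by [].
Qed.

End ExtendedIntegers.

(** * From the symmetric algebra to the Rees algebra and the fiber cone *)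

Section MonomialEvaluation.
Variables (K : choiceType) (S : comNzRingType) (v : K -> S).

Definition monom_eval (x : {cmonom K}) : S := \prod_(k <- finsupp x) v k ^+ x k.

Lemma monom_evalEw (d : {fset K}) (x : {cmonom K}) : (finsupp x `<=` d)%fset ->
  monom_eval x = \prod_(k <- d) v k ^+ x k.
Proof.
move=> le; apply: big_fset_incl => // k _ kx.
by move: kx; rewrite -cmE_eq0 => /eqP->; rewrite expr0.
Qed.

Lemma monom_eval_mmorphism : mmorphism monom_eval.
Proof.
split=> [x y|]; last by rewrite /monom_eval mdom1 big_seq_fset0.
rewrite (monom_evalEw (d := finsupp (mmul x y))) //.
rewrite (@monom_evalEw (finsupp (mmul x y)) x) ?mdomD ?fsubsetUl //.
rewrite (@monom_evalEw (finsupp (mmul x y)) y) ?mdomD ?fsubsetUr //.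
by rewrite -big_split; apply: eq_bigr => k _; rewrite cmM exprD.
Qed.

HB.instance Definition _ :=
  monalg.isMultiplicative.Build {cmonom K} S monom_eval monom_eval_mmorphism.

Lemma monom_evalU k : monom_eval (ucm k) = v k.
Proof. by rewrite /monom_eval mdomU big_seq_fset1 cmUU expr1. Qed.

End MonomialEvaluation.

Section ReesMap.
Variables (R : comNzRingType) (M : lmodType R) (theta : M -> R).
Hypothesis thetaP : forall a u v, theta (a *: u + v) = a * theta u + theta v.
Local Notation P := {malg R[{cmonom M}]}.
Local Notation I := (range theta).

Definition rees_map : P -> {poly R} :=
  mmap (@polyC R) (monom_eval (fun u => theta u *: 'X)).
HB.instance Definition _ := GRing.RMorphism.on rees_map.

Lemma rees_map_var u : rees_map (sym_var u) = theta u *: 'X.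
Proof. by rewrite /rees_map /sym_var mmapU /= polyC1 mul1r monom_evalU. Qed.

Lemma rees_mapZ a w : rees_map (a *: w) = a%:P * rees_map w.
Proof. exact: mmapZ. Qed.

Lemma rees_map_onto (iI : is_ideal I) : onto_rees I rees_map.
Proof.
apply: (onto_reesP (X := I)) => [|w|c|_ [u _ <-]].
- rewrite eqEsubset; split; first exact: sub_ideal_span.
  exact: ideal_span_min.
- change (rees_poly I (rees_map w)); rewrite /rees_map mmapE; apply: rees_poly_sum => x.
  apply: rees_polyM; first exact: rees_polyC.
  rewrite /monom_eval; elim/big_rec: _ => [|u f _ Bf].
    by rewrite -polyC1; apply: rees_polyC.
  apply: rees_polyM => //; elim: (x u) => [|k IH].
    by rewrite expr0 -polyC1; apply: rees_polyC.
  rewrite exprS; apply: rees_polyM => //; apply: rees_polyX => //; by exists u.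
- by exists (c%:A); change (rees_map (c%:A) = c%:P); rewrite rees_mapZ rmorph1 mulr1.
- by exists (sym_var u); apply: rees_map_var.
Qed.

Lemma rees_map_sym w : ideal_span (@sym_rel R M) w -> rees_map w = 0.
Proof.
move=> Sw; apply: (Sw [set w | rees_map w = 0]) => [|_ [a [u [v ->]]]] /=.
  split=> [|a x y /= x0 y0]; first exact: rmorph0.
  by rewrite rmorphD rmorphM /= x0 y0 mulr0 addr0.
rewrite rmorphB rmorphD /= rees_mapZ.
rewrite -> (rees_map_var (a *: u + v)), (rees_map_var u), (rees_map_var v).
rewrite thetaP mul_polyC.
by rewrite scalerDl scalerA subrr.
Qed.

(** A non-zero-divisor of R acts injectively on [R[t]], coefficient by coefficient. *)
Lemma rees_map_torsion w : @torsion R (sym_alg M) (api _ w) -> rees_map w = 0.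
Proof.
case=> s sreg; rewrite -linearZ -[0](raddf0 (api _)) => /apiE.
rewrite subr0 => /asboolP/rees_map_sym; rewrite rees_mapZ mul_polyC => sw0.
by apply/polyP => j; rewrite coef0; apply: sreg; rewrite mulr0 -coefZ sw0 coef0.
Qed.

Definition rees_pi (w : P) : rees_alg M := api _ (api _ w).

Lemma rees_pi_eq w w' : rees_pi w = rees_pi w' -> rees_map w = rees_map w'.
Proof.
move=> /apiE/asboolP; rewrite -rmorphB => /rees_map_torsion.
by rewrite rmorphB => /eqP; rewrite subr_eq0 => /eqP.
Qed.

Lemma rees_piP a w w' : rees_pi (a *: w + w') = a *: rees_pi w + rees_pi w'.
Proof. by rewrite /rees_pi !linearP. Qed.

Lemma rees_pi_surj x : exists w, rees_pi w = x.
Proof.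
by have [y <-] := api_surj x; have [w <-] := api_surj y; exists w.
Qed.

Variable m : idealr R.
Local Notation k := (residue_field m).
Local Notation ms := [set` (m : pred R)].
Local Notation T := (tensor (rees_alg M) k).

Definition fiber_pi (w : P) : T := tens (rees_pi w) 1.

Lemma fiber_piD w w' : fiber_pi (w + w') = fiber_pi w + fiber_pi w'.
Proof.
rewrite /fiber_pi /rees_pi !rmorphD /= -[api _ _ in LHS]scale1r.
by rewrite tens_linearl scale1r.
Qed.

Lemma fiber_piM w w' : fiber_pi (w * w') = fiber_pi w * fiber_pi w'.
Proof. by rewrite /fiber_pi /rees_pi !rmorphM /= [RHS]tensor_mulE mulr1. Qed.

Lemma fiber_pi1 : fiber_pi 1 = 1.
Proof. by rewrite /fiber_pi /rees_pi !rmorph1. Qed.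

(** Every element of [k] is the class of some [r] in R, which moves across the tensor sign. *)
Lemma fiber_pi_surj t : exists w, fiber_pi w = t.
Proof.
elim/tensor_ind: t => [|a x y t [w <-]].
  by exists 0; rewrite /fiber_pi /rees_pi !raddf0 tens0l.
have [w' <-] := rees_pi_surj x; have [r <-] := api_surj y.
exists ((a * r) *: w' + w).
have -> : api _ r = r *: (1 : k).
  by rewrite -[1](rmorph1 (api _)) -linearZ; congr api; exact: (esym (mulr1 r)).
rewrite /fiber_pi /rees_pi !linearP tens_linearl -scalerA; congr (_ *: _ + _).
have tensZ : tens (rees_pi w') (r *: (1 : k)) = (r : R) *: (tens (rees_pi w') 1 : T).
  by rewrite -[X in tens _ X]addr0 tens_linearr tens0r addr0.
exact: esym tensZ.
Qed.

Lemma fiber_piB w w' : fiber_pi (w - w') = fiber_pi w - fiber_pi w'.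
Proof. by apply/eqP; rewrite eq_sym subr_eq -fiber_piD subrK. Qed.

Hypothesis iI : is_ideal I.

(** The kernel is controlled by a bilinear map into [R[t]] modulo the polynomials with components in
    [B]: the scalar is lifted to R and multiplied by the image of the first factor in [R[It]]. Since
    [m I^j] lies in [B j], the choice of the lift does not matter. *)
Lemma fiber_pi_eq0 B w : graded_ideal ms I B -> fiber_pi w = 0 ->
  graded_preimage rees_map B w.
Proof.
move=> [iB BG BM Bm] w0.
pose Nset : {poly R} -> Prop := fun f => forall j, B j f`_j.
have NP : submodule_closed (V := {poly R}) Nset.
  split=> [j|a f g Nf Ng j]; first by rewrite coef0; apply: (ideal0 (iB j)).
  by rewrite coefD coefZ; apply: (idealP a (iB j)).
pose N := Submodule NP.
have [rep repP] := choice rees_pi_surj.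
have [sec secP] := choice (@api_surj R R^o m).
have [mapG _] := rees_map_onto iI.
have Nm (a b : R) (u : P) : @api R R^o m a = @api R R^o m b -> N ((a - b) *: rees_map u).
  move=> /apiE mab j; rewrite coefZ; apply: Bm; apply: ideal_mul_mem => //.
  exact: mapG.
pose h (x : rees_alg M) (c : k) := lpi N (sec c *: rees_map (rep x)).
have hl a x y c : h (a *: x + y) c = a *: h x c + h y c.
  rewrite /h; have -> : rees_map (rep (a *: x + y)) = a *: rees_map (rep x) + rees_map (rep y).
    rewrite -mul_polyC -rees_mapZ -rmorphD; apply: rees_pi_eq.
    by rewrite rees_piP !repP.
  rewrite -linearP; congr (lpi _ _).
  by rewrite scalerDr !scalerA mulrC.
have hr a x c d : h x (a *: c + d) = a *: h x c + h x d.
  rewrite /h -linearP; apply/lpiE; rewrite scalerA -scalerDl -scalerBl; apply: Nm.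
  have secL : @api R R^o m (a *: sec c + sec d) =
    a *: @api R R^o m (sec c) + @api R R^o m (sec d) by apply: linearP.
  by rewrite !secP in secL; rewrite secP; apply: esym secL.
have : tensor_lift h (fiber_pi w) = 0.
  by rewrite w0; apply: tensor_lift_0 hl hr.
rewrite /fiber_pi (tensor_liftE hl hr) /h (rees_pi_eq (repP (rees_pi w))).
rewrite -(linear0 (lpi N)) => /lpiE; rewrite subr0 => Nw j.
have [_ NL] := NP.
(* The chosen lift of 1 from the residue field is 1 only modulo [m]. *)
have res1 : @api R R^o m 1 = @api R R^o m (sec 1) by rewrite secP rmorph1.
have := NL 1 _ _ (Nm _ _ w res1) Nw.
by rewrite scale1r -scalerDl subrK scale1r => /(_ j).
Qed.

Lemma fiber_preimage B w : graded_ideal ms I B ->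
  (fiber_pi @` graded_preimage rees_map B) (fiber_pi w) -> graded_preimage rees_map B w.
Proof.
move=> gB [u Bu uw].
have iW := graded_preimage_ideal (rees_map_onto iI) gB.
have wu0 : fiber_pi (w - u) = 0 by rewrite fiber_piB uw subrr.
have := idealD iW (fiber_pi_eq0 gB wu0) Bu.
by rewrite subrK.
Qed.

(** By [fiber_pi_eq0] the prime upstairs contains the kernel of the surjection [fiber_pi], so its
    image is prime. *)
Lemma fiber_prime B : graded_prime ms I B ->
  is_prime_ideal (fiber_pi @` graded_preimage rees_map B).
Proof.
move=> pB; have gB := graded_prime_ideal pB; have onto := rees_map_onto iI.
have [iW W1 WM] := graded_preimage_prime onto pB; split.
- split.
    exists 0; first exact: ideal0.
    by rewrite -[0 in LHS](subrr 0) fiber_piB subrr.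
  move=> a _ _ [u Bu <-] [v Bv <-]; have [w <-] := fiber_pi_surj a.
  by exists (w * u + v); [exact: (idealP w iW Bu Bv)|rewrite fiber_piD fiber_piM].
- by move=> H; apply: W1; apply: (fiber_preimage gB); rewrite fiber_pi1.
move=> x y; have [u <-] := fiber_pi_surj x; have [v <-] := fiber_pi_surj y.
rewrite -fiber_piM => /(fiber_preimage gB)/WM[Wu|Wv]; [left|right].
  by exists u.
by exists v.
Qed.

Lemma fiber_prime_chain n q : graded_chain ms I n q ->
  prime_chain n (fun i => fiber_pi @` graded_preimage rees_map (q i)).
Proof.
move=> [qp qS]; split=> [i /qp|i ni]; first exact: fiber_prime.
have gq j : (j <= n)%N -> graded_ideal ms I (q j) by move=> /qp/graded_prime_ideal.
have [sub nsub] := graded_preimage_lt (rees_map_onto iI) (gq i (ltnW ni)) (gq _ ni) (qS i ni).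
split=> [_ [u Bu <-]|H]; first by exists u => //; apply: sub.
apply: nsub => u Bu; apply: (fiber_preimage (gq i (ltnW ni))); apply: H.
by exists u.
Qed.

End ReesMap.

Theorem corollary2p5 (R : comNzRingType) (m : idealr R) (E : lmodType R)
    (e : nat) (F : set R)
    (noethR : is_noetherian R) (localR : is_local m)
    (fgE : fin_gen E) (rankE : has_rank E e) (pdE : proj_dim E = 1%:Z%:E)
    (fittE : is_fitting_ideal E e F) :
  (ideal_height F <= analytic_spread m (ext_power E e))%O.
Proof.
set ms := [set` (m : pred R)].
have maxm : is_maximal_ideal ms by apply/localR.
have pm := maximal_prime maxm; have im := prime_ideal pm.
have [res1 nprojE] := proj_dim1 pdE.
have [k0 [n [phi [p [presphi ->]]]]] := fittE.
have [r [psi [pres injpsi]]] := free_presentation noethR localR res1 presphi.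
have En := rank_presentation pres injpsi rankE; subst n.
rewrite addnK; set F' := ideal_span _.
have FI : F' `<=` range (minor_map pres) := minors_sub_minor_map pres presphi.
have iI := minor_map_ideal pres; set I := range (minor_map pres) in FI iI.
have Im : I `<=` ms.
  apply: minor_map_sub => // x; apply: contrapT => /(local_unit noethR localR)[y yx].
  exact/nprojE/(minor_form_unit_projective yx).
pose T := tensor (rees_alg (ext_power E e)) (residue_field m).
pose chains := [set n | exists q, @prime_chain T n q].
have chain_of n q : graded_chain ms I n q -> chains n.
  by move=> cq; eexists; apply: (fiber_prime_chain (minor_mapP pres) iI cq).
have chain0 : chains 0%N.
  apply: (chain_of _ (fun=> irrelevant ms I)); split=> // i _; exact: irrelevant_prime.
rewrite /analytic_spread /krull_dim -/chains.
(* If chain lengths can always be increased, [chain0] makes the dimension infinite. Otherwise some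
   [k] is a chain length and [k + 1] is not, and this [k] bounds the height. *)
have [allc|/existsNP[k /not_implyP[ck nck]]] := pselect (forall n, chains n -> chains n.+1).
  have {}allc n : chains n by elim: n => // n; apply: allc.
  case Es : (supremum _ _) => [l||]; [|exact: leey|].
    have := supremum_ge (allc (`|l|%N.+1)); rewrite Es lee_fin.
    by case: l {Es} => l //=; rewrite lez_nat ltnn.
  by have := supremum_ge (allc 0%N); rewrite Es.
apply: le_trans (supremum_ge ck).
have [|fs [sfs fsI [N GN]]] := @fiber_reduction _ ms I noethR maxm iI k.
  by move=> q cq; apply: nck; apply: chain_of cq.
have [s Gs] := noethR _ (ideal_pow_ideal I N).
(* Some [t] outside [m] multiplies [I^N] into [(fs)]. The prime [Q] minimal over [(fs)] is taken
   inside [m], so it misses [t] and contains [I^N]. *)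
have [|t nmt tG] := nakayama pm (ideal_spanP [set` fs]) im (fun x mx => mx) Gs.
  move=> x Gx; have [y [z [fy mz Ex]]] := GN x Gx; exists 1, y, z; rewrite mul1r.
  by split=> //; case: pm.
have [|Q minQ Qm] := minimal_prime noethR (ideal_spanP [set` fs]) pm.
  by apply: ideal_span_min => // x /fsI/Im.
have [pQ fQ _] := minQ.
have IQ : I `<=` Q.
  apply: (prime_ideal_pow (n := N) pQ) => x /tG/fQ.
  by have [_ _ QM] := pQ; move=> /QM[/Qm|].
have hQ : (prime_height Q <= k%:Z%:E)%O.
  apply: supremum_le => _ [j [q cq qj] <-]; rewrite lee_fin lez_nat -sfs.
  exact: (krull_height noethR minQ cq qj).
apply: le_trans hQ.
have [||_ lb] := @infimum_mem [set prime_height P | P in [set P | is_prime_ideal P /\ F' `<=` P]].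
- by exists (prime_height Q); exists Q => //; split=> //; apply: subset_trans IQ.
- move=> _ [P [pP _] <-]; apply: (@supremum_ge _ 0%N); exists (fun=> P) => //; split=> //.
by apply: lb; exists Q => //; split=> //; apply: subset_trans IQ.
Qed.
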